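(* Let $\lVert \cdot \rVert_A$ and $\lVert \cdot \rVert_B$ be rearrangement-invariant quasi-Banach function norms over a non-atomic measure space $(\mathcal{R},\mu)$ of infinite measure such that the local component of $\lVert \cdot \rVert_A$ is stronger than that of $\lVert \cdot \rVert_B$ while the global component of $\lVert \cdot \rVert_B$ is stronger than that of $\lVert \cdot \rVert_A$. Then $A+B$ is a rearrangement-invariant quasi-Banach function space, in the sense that there exist an r.i. quasi-Banach function norm $\lVert\cdot\rVert$ over $(\mathcal{R},\mu)$ and constants $0<c\le C<\infty$ such that $c\lVert f\rVert\le\lVert f\rVert_{A+B}\le C\lVert f\rVert$ for all $f\in\mathcal{M}(\mathcal{R},\mu)$.
   Context: Measure spaces are $\sigma$-finite. $\lambda$ is Lebesgue measure on $[0,\infty)$. $\mathcal{M}(\mathcal{R},\mu)$ is the set of ($\mu$-a.e. equivalence classes of) measurable functions on $\mathcal{R}$ (infinite values are allowed), and $\mathcal{M}_+$ its cone of non-negative functions. The non-increasing rearrangement of $f$ is $f^*(t)=\inf\{s\ge 0:\ \mu(\{|f|>s\})\le t\}$, $t\in[0,\infty)$. An r.i. quasi-Banach function norm is a functional $\lVert\cdot\rVert:\mathcal{M}(\mathcal{R},\mu)\to[0,\infty]$ with $\lVert\,|f|\,\rVert=\lVert f\rVert$ such that: (quasinorm) $\lVert af\rVert=|a|\lVert f\rVert$ for $a\in\mathbb{C}$, $f\in\mathcal{M}_+$, $\lVert f\rVert=0\Leftrightarrow f=0$ a.e., and there is $K\ge1$ with $\lVert f+g\rVert\le K(\lVert f\rVert+\lVert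 g\rVert)$ for all $f,g\in\mathcal{M}_+$; (lattice property) $0\le f\le g$ a.e. implies $\lVert f\rVert\le\lVert g\rVert$; (Fatou property) $0\le f_n\uparrow f$ a.e. implies $\lVert f_n\rVert\uparrow\lVert f\rVert$; $\lVert\chi_E\rVert<\infty$ whenever $\mu(E)<\infty$; (rearrangement-invariance) $\lVert f\rVert=\lVert g\rVert$ whenever $f^*=g^*$. The corresponding r.i. quasi-Banach function space is $X=\{f\in\mathcal{M}(\mathcal{R},\mu):\lVert f\rVert_X<\infty\}$. Sum: $A+B=\{f: \exists f_A\in A, f_B\in B,\ f=f_A+f_B\}$ with $\lVert f\rVert_{A+B}=\inf\{\lVert f_A\rVert_A+\lVert f_B\rVert_B:\ f=f_A+f_B,\ f_A\in A,\ f_B\in B\}$ (with $\inf\emptyset=\infty$). Canonical representation quasinorm of $X$ (for $(\mathcal{R},\mu)$ non-atomic with $\mu(\mathcal{R})=\infty$): $\lVert g\rVert_{\overline{X}}=\lVert g^*\circ\sigma\rVert_X$ for $g\in\mathcal{M}([0,\infty),\lambda)$, where $\sigma:\mathcal{R}\to[0,\infty)$ is a measure-preserving map (the choice is irrelevant). It is the unique r.i. quasi-Banach function norm over $([0,\infty),\lambda)$ satisfying $\lVert f\rVert_X=\lVert f^*\rVert_{\overline{X}}$ for all $f\in\mathcal{M}(\mathcal{R},\mu)$. The local component of $\lVert\cdot\rVert_A$ is stronger than that of $\lVert\cdot\rVert_B$ if for every $f\in\mathcal{M}([0,\infty),\lambda)$: $\lVert f^*\chi_{[0,1]}\rVert_{\overline{A}}<\infty$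 implies $\lVert f^*\chi_{[0,1]}\rVert_{\overline{B}}<\infty$. The global component of $\lVert\cdot\rVert_B$ is stronger than that of $\lVert\cdot\rVert_A$ if for every $f\in\mathcal{M}([0,\infty),\lambda)$ with $f^*(1)<\infty$: $\lVert f^*\chi_{(1,\infty)}\rVert_{\overline{B}}<\infty$ implies $\lVert f^*\chi_{(1,\infty)}\rVert_{\overline{A}}<\infty$. *)

(* Defs.v *)
From HB Require Import structures.
From mathcomp Require Export all_boot all_order all_algebra.
From mathcomp Require Export complex.
From mathcomp Require Export all_classical all_reals all_analysis.
From mathcomp Require Export measurable_realfun.
Export Order.TTheory GRing.Theory Num.Theory.
Export numFieldNormedType.Exports.

Set Implicit Arguments.
Unset Strict Implicit.
Unset Printing Implicit Defensive.

Local Open Scope classical_set_scope.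
Local Open Scope ring_scope.
Local Open Scope ereal_scope.

(** Functions in [M(R, mu)] take values in the complex numbers extended by a
    single infinite value. *)
Inductive xcomplex (R : realType) : Type :=
| XFin of R[i]
| XInf.
Arguments XInf {R}.

Section XComplex.
Context {R : realType}.
Implicit Types x y : xcomplex R.

(** [XInf + XInf = XInf] matches the sum of non-negative extended reals.  For
    sums of elements of [A] and [B] this convention is immaterial: functions of
    finite norm are finite a.e. *)
Definition xadd x y : xcomplex R :=
  match x, y with
  | XFin z, XFin w => XFin (z + w)%R
  | _, _ => XInf
  end.

Definition xscale (a : R[i]) x : xcomplex R :=
  match x with
  | XFin z => XFin (a * z)%R
  | XInf => if a == 0%R then XFin 0%R else XInf
  end.

(** [`|z|] is complex-valued on [R[i]]; [Normc.normc] is the same modulus as an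
    element of [R]. *)
Definition xmod x : \bar R :=
  match x with
  | XFin z => (ComplexField.Normc.normc z)%:E
  | XInf => +oo
  end.

(** Only used for non-negative arguments, so [-oo] is irrelevant. *)
Definition of_ereal (r : \bar R) : xcomplex R :=
  match r with
  | r%:E => XFin (Complex r 0%R)
  | _ => XInf
  end.

Definition xRe x : R := match x with XFin z => complex.Re z | XInf => 0%R end.
Definition xIm x : R := match x with XFin z => complex.Im z | XInf => 0%R end.

End XComplex.

(** Borel measurability for the one-point compactification of the plane, in
    coordinates. *)
Definition xmeasurable (d : measure_display) (T : measurableType d)
    (R : realType) (f : T -> xcomplex R) : Prop :=
  [/\ measurable [set x | f x = XInf],
      measurable_fun setT (fun x => xRe (f x)) &
      measurable_fun setT (fun x => xIm (f x))].

(** The cone [M_+] consists of the functions [of_ereal \o f] with [f] as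
    below. *)
Definition Mplus (d : measure_display) (T : measurableType d)
    (R : realType) (f : T -> \bar R) : Prop :=
  measurable_fun setT f /\ (forall x, 0 <= f x).

Definition nonatomic (d : measure_display) (T : measurableType d)
    (R : realType) (mu : {measure set T -> \bar R}) : Prop :=
  forall E, measurable E -> 0 < mu E ->
    exists F, [/\ measurable F, F `<=` E, 0 < mu F & mu F < mu E].

Definition rearr (d : measure_display) (T : measurableType d) (R : realType)
    (mu : {measure set T -> \bar R}) (f : T -> xcomplex R) (t : R) : \bar R :=
  ereal_inf [set s%:E | s in
    [set s : R | (0 <= s)%R /\ mu [set x | s%:E < xmod (f x)] <= t%:E]].

(** A functional is given on all functions but constrained only on measurable
    ones.  It is compatible with a.e. equality by [qbfn_mod] and
    [qbfn_lattice], hence is a functional on equivalence classes. *)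
Record ri_qbf_norm (d : measure_display) (T : measurableType d)
    (R : realType) (mu : {measure set T -> \bar R})
    (N : (T -> xcomplex R) -> \bar R) : Prop := {
  qbfn_ge0 : forall f, xmeasurable f -> 0 <= N f;
  qbfn_mod : forall f, xmeasurable f ->
    N (fun x => of_ereal (xmod (f x))) = N f;
  qbfn_scale : forall (a : R[i]) (f : T -> \bar R), Mplus f ->
    N (fun x => xscale a (of_ereal (f x))) =
      (ComplexField.Normc.normc a)%:E * N (of_ereal \o f);
  qbfn_eq0 : forall f : T -> \bar R, Mplus f ->
    (N (of_ereal \o f) = 0 <-> {ae mu, forall x, f x = 0});
  qbfn_triangle : exists K : R, (1 <= K)%R /\
    forall f g : T -> \bar R, Mplus f -> Mplus g ->
      N (fun x => of_ereal (f x + g x)) <=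
        K%:E * (N (of_ereal \o f) + N (of_ereal \o g));
  qbfn_lattice : forall f g : T -> \bar R, Mplus f -> Mplus g ->
    {ae mu, forall x, f x <= g x} -> N (of_ereal \o f) <= N (of_ereal \o g);
  qbfn_fatou : forall (f_ : nat -> T -> \bar R) (f : T -> \bar R),
    (forall n, Mplus (f_ n)) -> Mplus f ->
    {ae mu, forall x, (forall n, f_ n x <= f_ n.+1 x) /\
                      f_ ^~ x @ \oo --> f x} ->
    (forall n, N (of_ereal \o f_ n) <= N (of_ereal \o f_ n.+1)) /\
    (fun n => N (of_ereal \o f_ n)) @ \oo --> N (of_ereal \o f);
  qbfn_indic : forall E : set T, measurable E -> mu E < +oo ->
    N (fun x => of_ereal (\1_E x)%:E) < +oo;
  qbfn_ri : forall f g, xmeasurable f -> xmeasurable g ->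
    (forall t : R, (0 <= t)%R -> rearr mu f t = rearr mu g t) -> N f = N g
}.

Definition sum_norm (d : measure_display) (T : measurableType d)
    (R : realType) (mu : {measure set T -> \bar R})
    (A B : (T -> xcomplex R) -> \bar R) (f : T -> xcomplex R) : \bar R :=
  ereal_inf [set r | exists fA fB : T -> xcomplex R,
    [/\ xmeasurable fA /\ A fA < +oo,
        xmeasurable fB /\ B fB < +oo,
        {ae mu, forall x, f x = xadd (fA x) (fB x)} &
        r = A fA + B fB]].

(** The half-line [[0, +oo[] is represented inside [R]: its measure is Lebesgue
    measure restricted to it, so the values of a function at negative arguments
    do not matter. *)
Definition lambda (R : realType) : {measure set (measurableTypeR R) -> \bar R} :=
  mrestr (@lebesgue_measure R) (measurable_itv `[0%R, +oo[).

Definition measure_preserving_half_line (d : measure_display)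
    (T : measurableType d) (R : realType) (mu : {measure set T -> \bar R})
    (s : T -> measurableTypeR R) : Prop :=
  [/\ measurable_fun setT s,
      forall x, (0 <= (s x : R))%R &
      forall E, measurable E -> mu (s @^-1` E) = lambda R E].

(** A chosen measure-preserving map onto the half-line; one exists whenever
    [mu] is sigma-finite, non-atomic and of infinite total mass. *)
Definition sigma_map (d : measure_display) (T : measurableType d)
    (R : realType) (mu : {measure set T -> \bar R}) : T -> measurableTypeR R :=
  xget (fun=> 0%R) [set s | measure_preserving_half_line mu s].

Definition canonical_norm (d : measure_display) (T : measurableType d)
    (R : realType) (mu : {measure set T -> \bar R})
    (N : (T -> xcomplex R) -> \bar R) (g : measurableTypeR R -> xcomplex R) :
    \bar R :=
  N (fun x => of_ereal (rearr (lambda R) g (sigma_map mu x))).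

Definition rearr_on (R : realType) (f : measurableTypeR R -> xcomplex R)
    (I : set R) : measurableTypeR R -> xcomplex R :=
  fun t => of_ereal (rearr (lambda R) f t * (\1_I t)%:E).

Definition local_component_stronger (d : measure_display)
    (T : measurableType d) (R : realType) (mu : {measure set T -> \bar R})
    (A B : (T -> xcomplex R) -> \bar R) : Prop :=
  forall f : measurableTypeR R -> xcomplex R, xmeasurable f ->
    canonical_norm mu A (rearr_on f `[0%R, 1%R]) < +oo ->
    canonical_norm mu B (rearr_on f `[0%R, 1%R]) < +oo.

Definition global_component_stronger (d : measure_display)
    (T : measurableType d) (R : realType) (mu : {measure set T -> \bar R})
    (B A : (T -> xcomplex R) -> \bar R) : Prop :=
  forall f : measurableTypeR R -> xcomplex R, xmeasurable f ->
    rearr (lambda R) f 1%R < +oo ->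
    canonical_norm mu B (rearr_on f `]1%R, +oo[) < +oo ->
    canonical_norm mu A (rearr_on f `]1%R, +oo[) < +oo.

(* Main.v *)
Require Import Defs.
From mathcomp Require Import ring lra.

Set Implicit Arguments.
Unset Strict Implicit.
Unset Printing Implicit Defensive.

(** The sum [A + B] is the Wiener-Luxemburg amalgam that is [B] locally and [A]
    globally: with [sigma] measure preserving onto the half-line, the norm is
    [N f = ||f^* chi_[0,1[ o sigma||_B + ||f^*(max(sigma, 1))||_A].

    - [sigma] comes from Sierpinski's theorem: a non-atomic measure takes all
      intermediate values, so there are nested sets of every dyadic measure.
    - [N] is a quasinorm because [(f + g)^*(t) <= f^*(t/2) + g^*(t/2)] and
      dilation is bounded, [f^*(sigma/2)] being equidistributed with two disjoint
      copies of [f^*(sigma)].  Its Fatou property, which the sum functional may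
      lack, holds because [f_n^*] increases to [f^*] when [f_n] increases
      to [f].
    - Cutting [f] at the level [f^*(1)] gives [||f||_(A+B) <= N f].
    - Conversely, a gliding hump argument upgrades the two inclusions between
      local and global components to norm inequalities, so that [N] is bounded
      by a multiple of [||.||_A] and of [||.||_B]. *)

Local Open Scope classical_set_scope.
Local Open Scope ring_scope.
Local Open Scope ereal_scope.

(** * Intermediate values of a non-atomic measure *)

(** The gliding hump sums a series of counterexamples, but rearrangement is not additive. The humps
    are therefore not rearrangements: they are functions on [T] that either vanish off the set where
    [sigma < 1], or are constant and maximal on it. Both classes are closed under countable sums,
    and their rearrangements are controlled well enough to apply the hypotheses on components. A
    non-increasing [h] on the half-line is handled through its distribution function [a], by the
    equivalence of [s < h t] and [t < a s]. This makes superlevel sets of [h] composed with [sigma]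
    sublevel sets of [sigma], so that measurability and measure come at once, and equidistribution
    reduces to comparing two functions of [s]. Since [sigma] need not be injective, a dilation of
    the half-line does not lift to [T] as a map. This is why dilation is bounded through two further
    half-line maps, each measure preserving on one of two complementary sets of infinite measure. *)

Section IntermediateMeasure.
Context d (T : measurableType d) (R : realType) (mu : {measure set T -> \bar R}).
Context (na : nonatomic mu).

(** The strict inequality in non-atomicity makes the first piece of finite measure even when [mu E]
    is infinite. After that, each split leaves two pieces of positive measure, one of which has at
    most half the measure; repeated halving gets below [e]. *)
Lemma nonatomic_small_subset (E : set T) (e : R) : measurable E -> 0 < mu E ->
  (0 < e)%R ->
  exists F, [/\ measurable F, F `<=` E, 0 < mu F & mu F < e%:E].
Proof.
move=> mE E0 e0.
have [F0 [mF0 F0E F00 F0l]] := na mE E0.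
have F0fin : mu F0 \is a fin_num.
  by rewrite ge0_fin_numE// (lt_le_trans F0l)// leey.
set r := fine (mu F0).
have r0 : (0 < r)%R by rewrite fine_gt0// F00 ltey_eq F0fin.
have halve n : exists F, [/\ measurable F, F `<=` E, 0 < mu F &
    mu F <= (r / 2 ^+ n)%:E].
  elim: n => [|n [F [mF FE F0' Fr]]].
    by exists F0; split => //; rewrite expr0 divr1 fineK.
  have [G [mG GF G0 Gl]] := na mF F0'.
  have Ffin : mu F \is a fin_num by rewrite ge0_fin_numE// (le_lt_trans Fr)// ltry.
  have Gfin : mu G \is a fin_num by rewrite ge0_fin_numE// (lt_le_trans Gl)// leey.
  have FG : mu (F `\` G) = mu F - mu G.
    by rewrite measureD//; [rewrite (setIidr GF)|rewrite -ge0_fin_numE].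
  have h2 : (r / 2 ^+ n = r / 2 ^+ n.+1 + r / 2 ^+ n.+1)%R.
    rewrite exprS invfM; have : (2 ^+ n != 0 :> R)%R by rewrite expf_neq0.
    by move=> ?; field.
  have [Gs|Gb] := leP (mu G) (r / 2 ^+ n.+1)%:E.
    by exists G; split => //; apply: subset_trans FE.
  exists (F `\` G); split.
  - exact: measurableD.
  - by apply: subset_trans FE; exact: subDsetl.
  - by rewrite FG sube_gt0.
  - rewrite FG -(fineK Ffin) -(fineK Gfin) -EFinB lee_fin.
    move: Fr Gb; rewrite -(fineK Ffin) -(fineK Gfin) lee_fin lte_fin h2.
    by move: (fine (mu F)) (fine (mu G)) (r / _)%R => a b c /=; lra.
have [n nP] : exists n, (r / 2 ^+ n < e)%R.
  have [n _ nP] := near_infty_natSinv_expn_lt (PosNum (divr_gt0 e0 r0)).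
  exists n; move: (nP n (leqnn n)) => /=.
  by rewrite ltr_pdivlMr// mulrC mulrA mulr1.
have [F [mF FE F0' Fr]] := halve n.
by exists F; split => //; rewrite (le_lt_trans Fr)// lte_fin.
Qed.

(* Greedy exhaustion: each step captures at least half of the measure that can
   still be added. *)
Lemma nonatomic_subset (E : set T) (r : R) : measurable E -> (0 <= r)%R ->
  r%:E <= mu E -> exists F, [/\ measurable F, F `<=` E & mu F = r%:E].
Proof.
move=> mE r0 rE.
pose good G := [/\ measurable G, G `<=` E & mu G <= r%:E].
have goodfin G : good G -> mu G \is a fin_num.
  by move=> [mG _ Gr]; rewrite ge0_fin_numE// (le_lt_trans Gr)// ltry.
(* The measure of [Y] is at least midway between that of [X] and that of any good set containing
   [X]. *)
pose step (X Y : {G | good G}) := sval X `<=` sval Y /\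
  forall Z, good Z -> sval X `<=` Z ->
    (fine (mu Z) + fine (mu (sval X)) <= 2 * fine (mu (sval Y)))%R.
have stepP X : {Y | step X Y}.
  apply: cid; case: X => X gX.
  pose V := [set fine (mu Z) | Z in [set Z | good Z /\ X `<=` Z]].
  have VX : V (fine (mu X)) by exists X => //; split.
  have Vub : has_sup V.
    split; first by exists (fine (mu X)).
    exists r => _ [Z [gZ _] <-]; rewrite -lee_fin fineK ?goodfin//.
    by have [] := gZ.
  have Vle : (fine (mu X) <= sup V)%R by apply: sup_upper_bound.
  have [eqs|nes] := eqVneq (fine (mu X)) (sup V).
    exists (exist _ X gX); split => //= Z gZ XZ; rewrite mulr_natl mulr2n lerD2r.
    by rewrite eqs; apply: sup_upper_bound => //; exists Z.
  have lts : (0 < (sup V - fine (mu X)) / 2)%R.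
    by rewrite divr_gt0// subr_gt0 lt_neqAle nes Vle.
  have [_ [Y [gY XY] <-] Ylt] := sup_adherent lts Vub.
  exists (exist _ Y gY); split => //= Z gZ XZ.
  have : (fine (mu Z) <= sup V)%R by apply: sup_upper_bound => //; exists Z.
  by move: (sup V) (fine (mu Z)) (fine (mu X)) (fine (mu Y)) Ylt => s z x y /=; lra.
have g0 : good set0 by split => //; rewrite measure0 lee_fin.
have [f [_ fS]] := dependent_choice stepP (exist _ set0 g0).
pose g n := sval (f n); have gg n : good (g n) by exact: (svalP (f n)).
have mg n : measurable (g n) by have [] := gg n.
pose F := \bigcup_n g n.
have gmono : nondecreasing_seq g.
  by apply/nondecreasing_seqP => n; apply/subsetPset; have [] := fS n.
have mF : measurable F by exact: bigcupT_measurable.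
have Fcvg : mu \o g @ \oo --> mu F by exact: nondecreasing_cvg_mu.
have Fr : mu F <= r%:E.
  rewrite -(cvg_lim _ Fcvg)//; apply: lime_le; first by apply/cvg_ex; eexists; exact: Fcvg.
  by near=> n; have [] := gg n.
have FE : F `<=` E by move=> x [n _ gx]; have [_ /(_ x gx)] := gg n.
have Ffin : mu F \is a fin_num by rewrite ge0_fin_numE// (le_lt_trans Fr)// ltry.
exists F; split => //; apply/eqP; rewrite eq_le Fr/= leNgt; apply/negP => Flt.
(* If the union [F] fell short of [r], a small [H] outside it could be added to form a good set
   containing every [g n]. The midway inequality then gives [mu (g n) <= mu F - mu H] for all [n],
   which contradicts the convergence to [mu F]. *)
have EF0 : 0 < mu (E `\` F).
  rewrite lt0e measure_ge0 andbT; apply/eqP => EF0.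
  have : mu E <= mu F + mu (E `\` F).
    rewrite -[leLHS](_ : mu (F `|` (E `\` F)) = _); last by rewrite setDUK.
    by apply: measureU2 => //; exact: measurableD.
  by rewrite EF0 adde0 leNgt (lt_le_trans Flt rE).
have e0 : (0 < r - fine (mu F))%R.
  by rewrite subr_gt0 -lte_fin fineK.
have [H [mH HEF H0 Hl]] := nonatomic_small_subset (measurableD mE mF) EF0 e0.
have Hfin : mu H \is a fin_num by rewrite ge0_fin_numE// (lt_le_trans Hl)// leey.
have FH : mu (F `|` H) = mu F + mu H.
  rewrite measureU//; apply/seteqP; split => // x [Fx Hx].
  by have [_] := HEF _ Hx.
have gFH : good (F `|` H).
  split; first exact: measurableU.
    by rewrite subUset; split => // x /HEF [].
  rewrite FH -(fineK Ffin) -(fineK Hfin) -EFinD lee_fin.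
  move: Hl; rewrite -(fineK Hfin) lte_fin; by move: (fine (mu H)) (fine (mu F)) => a b /=; lra.
have bnd n : mu (g n) <= (fine (mu F) - fine (mu H))%:E.
  have [_ /(_ _ gFH)] := fS n.
  rewrite -/(g n) -/(g n.+1) FH.
  have -> : fine (mu F + mu H) = (fine (mu F) + fine (mu H))%R.
    by rewrite fineD.
  move=> /(_ (fun x gx => or_introl (ex_intro2 _ _ n I gx))).
  have : (fine (mu (g n.+1)) <= fine (mu F))%R.
    rewrite fine_le ?goodfin//; apply: le_measure; rewrite ?inE// => x gx.
    by exists n.+1.
  rewrite -[mu (g n)]fineK ?goodfin// lee_fin.
  by move: (fine (mu F)) (fine (mu H)) (fine _) (fine _) => a b u v /=; lra.
have : mu F <= (fine (mu F) - fine (mu H))%:E.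
  rewrite -{1}(cvg_lim _ Fcvg)//; apply: lime_le; first by apply/cvg_ex; eexists; exact: Fcvg.
  by near=> n; exact: bnd.
rewrite -{1}(fineK Ffin) lee_fin => Hle.
have : (0 < fine (mu H))%R by rewrite fine_gt0// H0 ltey_eq Hfin.
by move: (fine (mu F)) (fine (mu H)) Hle => a b /=; lra.
Unshelve. all: by end_near.
Qed.

(** The two-sided form is what allows a chain of sets to be refined between two of its members. *)
Lemma nonatomic_intermediate (A B : set T) (r : R) : measurable A -> measurable B ->
  A `<=` B -> mu A <= r%:E -> r%:E <= mu B ->
  exists C, [/\ measurable C, A `<=` C, C `<=` B & mu C = r%:E].
Proof.
move=> mA mB AB Ar rB.
have Afin : mu A \is a fin_num by rewrite ge0_fin_numE// (le_lt_trans Ar)// ltry.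
have BA : mu B = mu A + mu (B `\` A).
  rewrite -measureU//; [by rewrite setDUK|exact: measurableD|].
  by apply/seteqP; split => // x [? []].
have [||F [mF FB Fr]] := @nonatomic_subset (B `\` A) (r - fine (mu A)) (measurableD mB mA).
- by rewrite subr_ge0 -lee_fin fineK.
- by rewrite EFinB fineK// leeBlDl// -BA.
exists (A `|` F); split => //.
- exact: measurableU.
- by rewrite subUset; split => // x /FB [].
- have -> : mu (A `|` F) = mu A + mu F.
    by rewrite measureU//; apply/seteqP; split => // x [Ax /FB []].
  by rewrite Fr -{1}(fineK Afin) -EFinD addrC subrK.
Qed.

End IntermediateMeasure.

(** * A measure-preserving map onto the half-line *)

Lemma dyadic_dense (R : realType) (a b : R) : (0 <= a)%R -> (a < b)%R ->
  exists k j, (a < j%:R / 2 ^+ k < b)%R.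
Proof.
move=> a0 ab.
have ba : (0 < b - a)%R by rewrite subr_gt0.
have [k _ /(_ k (leqnn k))/= kP] := near_infty_natSinv_expn_lt (PosNum ba).
have p0 : (0 < 2 ^+ k :> R)%R by rewrite exprn_gt0.
have /andP[h1 h2] := truncn_itv (mulr_ge0 a0 (ltW p0)).
exists k, (Num.trunc (a * 2 ^+ k)).+1; apply/andP; split.
  by rewrite ltr_pdivlMr.
rewrite -natr1 mulrDl (@le_lt_trans _ _ (a + 1 / 2 ^+ k)%R)//.
  by rewrite lerD2r ler_pdivrMr.
by rewrite -ltrBrDl.
Qed.

Section HalfLineMap.
Context d (T : measurableType d) (R : realType) (mu : {measure set T -> \bar R}).
Context (na : nonatomic mu) (sf : sigma_finite setT mu) (muT : mu setT = +oo).

(* Keeping every [D n] comparable with each term of an exhausting sequence of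
   sets of finite measure forces the [D n] to exhaust [T] as well. *)
Lemma exhausting_chain : exists D : nat -> set T,
  [/\ forall n, measurable (D n), forall n, D n `<=` D n.+1,
      forall n, mu (D n) = n%:R%:E & forall x, exists n, D n x].
Proof.
have /sigma_finiteP[S0 [S0T S0mono S0P]] := sf.
pose S n := if n is m.+1 then S0 m else set0.
have mS n : measurable (S n) by case: n => //= n; have [] := S0P n.
have Sfin n : mu (S n) < +oo.
  by case: n => /= [|n]; [rewrite measure0|have [] := S0P n].
have SS n m : (n <= m)%N -> S n `<=` S m.
  case: n m => [|n] [|m]//= nm; try exact: sub0set.
  exact/subsetPset/S0mono.
have S0cvg : mu \o S0 @ \oo --> mu setT.
  rewrite S0T; apply: nondecreasing_cvg_mu => //.
  - by move=> i; have [] := S0P i.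
  - by rewrite -S0T.
have Soo r : exists n, r%:E < mu (S n).
  apply: contrapT => /forallNP Sr.
  have : mu setT <= r%:E.
    rewrite -(cvg_lim _ S0cvg)//; apply: lime_le; first by apply/cvg_ex; eexists; exact: S0cvg.
    by near=> n; rewrite leNgt; apply/negP; exact: (Sr n.+1).
  by rewrite muT leye_eq.
pose good (p : nat * set T) := [/\ measurable p.2, mu p.2 = p.1%:R%:E &
  forall k, p.2 `<=` S k \/ S k `<=` p.2].
pose step (X Y : {p | good p}) := (sval Y).1 = (sval X).1.+1 /\
  (sval X).2 `<=` (sval Y).2.
have stepP X : {Y | step X Y}.
  apply: cid; case: X => -[n D] gX; have [/= mD muD cD] := gX.
  have ex : exists k, n.+1%:R%:E < mu (D `|` S k).
    have [k kP] := Soo n.+1%:R; exists k; apply: (lt_le_trans kP).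
    by apply: le_measure; rewrite ?inE//; exact: measurableU.
  (* At the least index [j.+1] where [D] together with [S j.+1] exceeds [n.+1], the new set is
     squeezed between the unions for [j] and [j.+1]. It then contains [S k] for [k <= j], and lies
     in [S k] for [k > j] because [D] lies in [S j.+1]; this preserves comparability. *)
  case: (ex_minnP ex) => -[|j].
    by rewrite /= setU0 muD lte_fin ltr_nat ltnNge leqnSn.
  move=> jP jmin.
  have DjP : mu (D `|` S j) <= n.+1%:R%:E.
    by rewrite leNgt; apply/negP => /jmin; rewrite ltnn.
  have DS : D `<=` S j.+1.
    case: (cD j.+1) => // SD; move: jP.
    by rewrite setUidl// muD lte_fin ltr_nat ltnNge leqnSn.
  have [|||||C [mC DC CS muC]] := @nonatomic_intermediate _ _ _ mu na
    (D `|` S j) (D `|` S j.+1) n.+1%:R.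
  - exact: measurableU.
  - exact: measurableU.
  - exact/setUS/SS.
  - exact: DjP.
  - exact: ltW.
  have gC : good (n.+1, C).
    split => // k /=; have [kj|jk] := leqP k j.
      by right => x /(SS _ _ kj) Sx; apply: DC; right.
    left => x /CS [/DS|] Sx; exact: (SS _ _ jk).
  by exists (exist _ _ gC); split => //= x Dx; apply: DC; left.
have g0 : good (0%N, set0).
  by split; rewrite /= ?measure0// => k; left.
have [f [f0 fS]] := dependent_choice stepP (exist _ _ g0).
have f1 n : (sval (f n)).1 = n.
  by elim: n => [|n IH]; [rewrite f0|have [-> _] := fS n; rewrite IH].
have gf n : good (sval (f n)) := svalP (f n).
have muf n : mu (sval (f n)).2 = n%:R%:E by have [_ -> _] := gf n; rewrite f1.
exists (fun n => (sval (f n)).2); split => // n.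
- by have [] := gf n.
- by have [] := fS n.
- have : [set: T] n by [].
  rewrite S0T => -[k _ Sk].
  (* Once [m] exceeds the measure of [S k.+1], the set of measure [m] cannot lie inside [S k.+1], so
     by comparability it contains it. *)
  have Skfin : mu (S k.+1) \is a fin_num by rewrite ge0_fin_numE.
  pose m := (Num.trunc (fine (mu (S k.+1)))).+1.
  exists m; have [_ _ /(_ k.+1)[fS'|]] := gf m; last exact.
  have : mu (sval (f m)).2 <= mu (S k.+1).
    by apply: le_measure; rewrite ?inE//; have [] := gf m.
  rewrite muf -(fineK Skfin) lee_fin leNgt /m.
  by have /andP[_ ->] := truncn_itv (fine_ge0 (measure_ge0 mu (S k.+1))).
Unshelve. all: by end_near.
Qed.

(** Level [k.+1] keeps the sets of level [k] at even indices and inserts a set of intermediate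
    measure at odd ones. Sets of different levels are compared by lifting both to level [k + k']. *)
Lemma dyadic_chain : exists D : nat -> nat -> set T,
  [/\ forall k j, measurable (D k j),
      forall k j k' j', (j%:R / 2 ^+ k <= j'%:R / 2 ^+ k' :> R)%R ->
        D k j `<=` D k' j',
      forall k j, mu (D k j) = (j%:R / 2 ^+ k)%:E &
      forall x, exists n, D 0%N n x].
Proof.
have [D0 [mD0 D0S muD0 D0T]] := exhausting_chain.
pose mids (p : set T * set T) (C : set T) := forall r s : R,
  measurable p.1 -> measurable p.2 -> p.1 `<=` p.2 ->
  mu p.1 = r%:E -> mu p.2 = s%:E ->
  [/\ measurable C, p.1 `<=` C, C `<=` p.2 & mu C = ((r + s) / 2)%:E].
(* [mid] is total: for pairs that are not nested measurable sets of finite measure, [mids] is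
   vacuous and [set0] serves as default. *)
have [mid midP] : {mid : set T * set T -> set T & forall p, mids p (mid p)}.
  apply: choice => -[A B].
  have [[r [s [mA mB AB [Ar Bs]]]]|H] := pselect (exists r s : R,
      [/\ measurable A, measurable B, A `<=` B & mu A = r%:E /\ mu B = s%:E]);
    last first.
    by exists set0 => r s /= *; exfalso; apply: H; exists r, s.
  have rs : (r <= s)%R.
    by rewrite -lee_fin -Ar -Bs; apply: le_measure; rewrite ?inE.
  have [||C [mC AC CB muC]] := @nonatomic_intermediate _ _ _ mu na A B ((r + s) / 2)%R mA mB AB.
  - by rewrite Ar lee_fin; lra.
  - by rewrite Bs lee_fin; lra.
  exists C => r' s' /= _ _ _; rewrite Ar Bs => -[<-] [<-].
  by split.
pose D := fix D (k j : nat) {struct k} : set T := if k is k'.+1 then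
  if odd j then mid (D k' j./2, D k' j./2.+1) else D k' j./2 else D0 j.
have DE k j : D k.+1 j =
  if odd j then mid (D k j./2, D k j./2.+1) else D k j./2 by [].
have DP k j : [/\ measurable (D k j), D k j `<=` D k j.+1 &
    mu (D k j) = (j%:R / 2 ^+ k)%:E].
  elim: k j => [j|k IH j].
    by split => //; rewrite expr0 divr1.
  have [mA AB Ar] := IH j./2; have [mB _ Br] := IH j./2.+1.
  have [mC AC CB Cr] := midP (_, _) _ _ mA mB AB Ar Br.
  have p0 : (2 ^+ k != 0 :> R)%R by rewrite expf_neq0.
  have jE : (j%:R = (odd j)%:R + 2 * (j./2)%:R :> R)%R.
    by rewrite -{1}(odd_double_half j) natrD -mul2n natrM.
  rewrite !DE /= jE uphalf_half; case: (odd j) => /=; rewrite ?add1n ?add0n.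
    split => //; rewrite Cr; congr EFin; rewrite exprS -natr1.
    by field.
  split => //; rewrite Ar; congr EFin; rewrite exprS.
  by field.
have Dmono k : {homo D k : i j / (i <= j)%N >-> i `<=` j}.
  apply: (homo_leq (fun _ => @subset_refl _ _)); first exact: subset_trans.
  by move=> j; have [] := DP k j.
have Dlift k m j : D k j = D (k + m)%N (j * 2 ^ m)%N.
  elim: m => [|m IH]; first by rewrite addn0 muln1.
  by rewrite addnS DE expnS mulnCA oddM /= mul2n doubleK -IH.
exists D; split => //.
- by move=> k j; have [] := DP k j.
- move=> k j k' j' jj'; rewrite (Dlift k k' j) (Dlift k' k j') addnC.
  apply: Dmono.
  move: jj'; rewrite ler_pdivrMr ?exprn_gt0// mulrAC ler_pdivlMr ?exprn_gt0//.
  by rewrite -!natrX -!natrM ler_nat.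
- by move=> k j; have [] := DP k j.
Qed.

(** [s x] is the infimum of the measures of the dyadic sets containing [x]. The set where [s < t] is
    the union of the sets of the chain with measure below [t]; it contains each of these and lies in
    every set of the chain with measure above [t], so density of the dyadics gives it measure
    [t]. *)
Lemma half_line_map : exists s : T -> R,
  [/\ measurable_fun setT s, forall x, (0 <= s x)%R &
      forall t : R, (0 <= t)%R -> mu [set x | (s x < t)%R] = t%:E].
Proof.
have [D [mD DD muD DT]] := dyadic_chain.
pose V x : set R := [set r | exists k j, r = (j%:R / 2 ^+ k)%R /\ D k j x].
pose s x := inf (V x).
have V0 x r : V x r -> (0 <= r)%R.
  by move=> [k [j [-> _]]]; rewrite divr_ge0// exprn_ge0.
have Vinf x : has_inf (V x).
  split; last by exists 0%R => r /V0.
  by have [n Dn] := DT x; exists (n%:R / 2 ^+ 0)%R, 0%N, n.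
have s0 x : (0 <= s x)%R.
  by apply: lb_le_inf; [exact: (Vinf x).1|move=> r /V0].
have sltP x (t : R) : (s x < t)%R <-> exists k j, (j%:R / 2 ^+ k < t)%R /\ D k j x.
  split.
    by move=> /(inf_lt (Vinf x).1)[r [k [j [-> Dx]]] rt]; exists k, j.
  move=> [k [j [jt Dx]]]; apply: le_lt_trans jt.
  by apply: ge_inf; [exact: (Vinf x).2|exists k, j].
have sltE (t : R) : [set x | (s x < t)%R] =
    \bigcup_k \bigcup_(j in [set j | (j%:R / 2 ^+ k < t)%R]) D k j.
  apply/seteqP; split => x /=.
    by move=> /sltP[k [j [jt Dx]]]; exists k => //; exists j.
  by move=> [k _ [j jt Dx]]; apply/sltP; exists k, j.
have mslt (t : R) : measurable [set x | (s x < t)%R].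
  by rewrite sltE; apply: bigcupT_measurable => k; apply: bigcup_measurable.
exists s; split => //.
  apply: (measurability _ (RGenInftyO.measurableE R)) => _ [_ [t ->] <-].
  by rewrite setTI preimage_itvNyo; exact: mslt.
move=> t t0; apply/eqP; rewrite eq_le; apply/andP; split.
  apply/lee_addgt0Pr => e e0.
  have te : (t < t + e)%R by rewrite ltrDl.
  have [k [j /andP[tj je]]] := dyadic_dense t0 te.
  rewrite (@le_trans _ _ (mu (D k j)))//; last by rewrite muD lee_fin ltW.
  apply: le_measure; rewrite ?inE// => x /sltP[k' [j' [jt Dx]]].
  by apply: DD Dx; rewrite (ltW (lt_trans jt tj)).
have H a : (0 <= a < t)%R -> a%:E <= mu [set x | (s x < t)%R].
  move=> /andP[a0 at_].
  have [k [j /andP[tj je]]] := dyadic_dense a0 at_.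
  rewrite (@le_trans _ _ (mu (D k j)))//; first by rewrite muD lee_fin ltW.
  apply: le_measure; rewrite ?inE// => x Dx.
  by apply/sltP; exists k, j.
have [->|tn0] := eqVneq t 0%R; first exact: measure_ge0.
have tp : (0 < t)%R by rewrite lt_neqAle eq_sym tn0.
apply/lee_addgt0Pr => e e0; rewrite -leeBlDr//.
have [te|et] := leP t e; last by rewrite -EFinB H// subr_ge0 ltW//= ltrBlDr ltrDl.
by rewrite (@le_trans _ _ 0)// ?measure_ge0// -EFinB lee_fin subr_le0.
Qed.

End HalfLineMap.

Section MeasurePreserving.
Context d (T : measurableType d) (R : realType) (mu : {measure set T -> \bar R}).

Lemma lambdaE (A : set R) : lambda R A = lebesgue_measure (A `&` `[0%R, +oo[%classic).
Proof. by []. Qed.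

Lemma lambda_ltr (a : R) : (0 <= a)%R -> lambda R (`]-oo, a[%classic : set R) = a%:E.
Proof.
move=> a0; rewrite lambdaE (_ : _ `&` _ = `[0%R, a[%classic).
  rewrite lebesgue_measure_itv /= lte_fin; case: ltgtP a0 => // [a0 _|<- _ //].
  by rewrite -EFinB subr0.
by apply/seteqP; split => x; rewrite /= !in_itv /= ?andbT; [move=> [-> ->]|move=> /andP[-> ->]].
Qed.

(** The rays []-oo, a[] are stable under intersection and generate the Borel sets, and those with
    natural endpoint cover the line with finite measure, so uniqueness of measures applies to the
    pushforward of [mu]. *)
Lemma measure_preservingP (s : T -> measurableTypeR R) :
  measurable_fun setT s -> (forall x, (0 <= (s x : R))%R) ->
  (forall t : R, (0 <= t)%R -> mu [set x | ((s x : R) < t)%R] = t%:E) ->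
  measure_preserving_half_line mu s.
Proof.
move=> ms s0 smu; split => // E mE.
have P (a : R) : mu (s @^-1` (`]-oo, a[%classic : set R)) = lambda R (`]-oo, a[%classic : set R).
  rewrite preimage_itvNyo; have [a0|a0] := leP 0%R a.
    by rewrite lambda_ltr// smu.
  have -> : [set x | ((s x : R) < a)%R] = set0.
    by apply/seteqP; split => x //= xa; have := s0 x; lra.
  have I0 : (`]-oo, a[%classic : set R) `&` `[0%R, +oo[%classic = set0.
    by apply/seteqP; split => x //= [/[!in_itv]/= xa /andP[x0 _]]; lra.
  by rewrite measure0 lambdaE I0 measure0.
pose m1 : {measure set (measurableTypeR R) -> \bar R} :=
  measure_function_pushforward__canonical__measure_function_Measure mu ms.
apply: (@measure_unique _ R (measurableTypeR R) (RGenInftyO.G (R := R))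
  (fun n => (`]-oo, n%:R[%classic : set R)) _ _ _ _ m1 (lambda R)) => //.
- exact: RGenInftyO.measurableE.
- move=> _ _ [a ->] [b ->]; exists (Num.min a b).
  by apply/seteqP; split => x; rewrite /= !in_itv /= lt_min; [move=> [-> ->]|move=> /andP[]].
- by move=> n; exists n%:R.
- apply/seteqP; split => // x _.
  exists (Num.trunc `|x|%R).+1 => //=; rewrite in_itv /=.
  have /andP[_] := truncn_itv (normr_ge0 x); apply: le_lt_trans.
  exact: ler_norm.
- by move=> _ [a ->]; exact: P.
- by move=> n; rewrite (P n%:R : m1 _ = _) lambda_ltr ?ltry.
Qed.

End MeasurePreserving.

Section SigmaMap.
Context d (T : measurableType d) (R : realType) (mu : {measure set T -> \bar R}).
Context (na : nonatomic mu) (sf : sigma_finite setT mu) (muT : mu setT = +oo).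

(** Existence ensures that the choice in [sigma_map] does not fall back on its default, the zero
    map. *)
Lemma sigma_mapP : measure_preserving_half_line mu (sigma_map mu).
Proof.
have [s [ms s0 smu]] := half_line_map na sf muT.
have sP := @measure_preservingP _ _ _ mu s ms s0 smu.
exact: (xgetPex (fun=> 0%R)
  (ex_intro [set s' | measure_preserving_half_line mu s'] s sP)).
Qed.

End SigmaMap.

(** * Rearrangements *)

Section ExtendedComplex.
Context (R : realType).

Lemma xmod_ge0 (z : xcomplex R) : 0 <= xmod z.
Proof. by case: z => [[a b]|] //=; rewrite lee_fin sqrtr_ge0. Qed.

Lemma xmod_of_ereal (r : \bar R) : 0 <= r -> xmod (of_ereal r) = r.
Proof.
case: r => [r| |] //=; rewrite lee_fin => r0.
by rewrite expr0n /= addr0 sqrtr_sqr ger0_norm.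
Qed.

End ExtendedComplex.

Section Rearrangement.
Context d (T : measurableType d) (R : realType) (mu : {measure set T -> \bar R}).
Implicit Types (u v : T -> \bar R) (s t : R).

(** [rearr] with the modulus taken out: [rearr mu f] is [rearrf mu] of [xmod] after [f], so the
    calculus can stay with extended real functions. *)
Definition rearrf u t : \bar R :=
  ereal_inf [set s%:E | s in
    [set s : R | (0 <= s)%R /\ mu [set x | s%:E < u x] <= t%:E]].

Lemma measurable_lt_fun u (a : \bar R) : measurable_fun setT u ->
  measurable [set x | a < u x].
Proof.
move=> mu_; rewrite -[X in measurable X]setTI.
exact: (measurable_lte measurableT (@measurable_cst _ _ _ _ setT a) mu_).
Qed.

Lemma measurable_fun_ltP u : (forall x, 0 <= u x) ->
  (forall s, (0 <= s)%R -> measurable [set x | s%:E < u x]) -> measurable_fun setT u.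
Proof.
move=> u0 mlt _; apply: (measurability _ (ErealGenOInfty.measurableE R)) => //.
move=> _ [_ [r ->] <-]; rewrite setTI preimage_itvoy.
have [r0|r0] := leP 0%R r; first exact: mlt.
rewrite (_ : [set x | _] = setT)//; apply/seteqP; split => // x _ /=.
by rewrite (lt_le_trans _ (u0 x))// lte_fin.
Qed.

(** The distribution function is right-continuous, since the set where [u > s] is the increasing
    union of the sets where [u > s + 1/(n+1)]. Hence the infimum in [rearrf] is attained when it is
    finite, and rearrangement and distribution function determine each other. *)
Lemma lt_rearrf u s t : measurable_fun setT u -> (0 <= s)%R ->
  (s%:E < rearrf u t) = (t%:E < mu [set x | s%:E < u x]).
Proof.
move=> mu_ s0; apply/idP/idP; last first.
  apply: contraTT; rewrite -!leNgt => H.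
  have {H} H e : (0 < e)%R -> mu [set x | (s + e)%:E < u x] <= t%:E.
    move=> e0; have : rearrf u t < (s + e)%:E.
      by apply: le_lt_trans H _; rewrite lte_fin ltrDl.
    move=> /ereal_inf_lt[_ [r [r0 rt] <-]] rs; apply: le_trans rt.
    apply: le_measure; rewrite ?inE; try exact: measurable_lt_fun.
    by move=> x /=; apply: lt_trans.
  pose F n := [set x | (s + n.+1%:R^-1)%:E < u x].
  have FE : [set x | s%:E < u x] = \bigcup_n F n.
    apply/seteqP; split => x /=; last first.
      by move=> [n _]; apply: lt_trans; rewrite lte_fin ltrDl invr_gt0.
    move=> sux.
    have [r sr ru] : exists2 r, (s < r)%R & r%:E <= u x.
      case: (u x) sux => [r| |] //= sux; first by exists r.
      by exists (s + 1)%R; rewrite ?leey// ltrDl.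
    have rs0 : (0 < r - s)%R by rewrite subr_gt0.
    have [n _ /(_ n (leqnn n)) /= nP] := near_infty_natSinv_lt (PosNum rs0).
    exists n => //=; apply: lt_le_trans ru; rewrite lte_fin.
    by rewrite -ltrBrDl.
  have mF n : measurable (F n) by exact: measurable_lt_fun.
  have Fcvg : mu \o F @ \oo --> mu (\bigcup_n F n).
    apply: nondecreasing_cvg_mu => //; first exact: bigcupT_measurable.
    move=> n m nm; apply/subsetPset => x /=; apply: le_lt_trans.
    by rewrite lee_fin lerD2l lef_pV2 ?posrE// ler_nat.
  rewrite FE -(cvg_lim _ Fcvg)//; apply: lime_le; first by apply/cvg_ex; eexists; exact: Fcvg.
  by near=> n; apply: H; rewrite invr_gt0.
apply: contraTT; rewrite -!leNgt => H.
by apply: ereal_inf_lbound; exists s.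
Unshelve. all: by end_near.
Qed.

End Rearrangement.

(* [h] is non-increasing on the half-line, with distribution function [a]; nothing
   is required at negative arguments. *)
Definition distr (R : realType) (h a : R -> \bar R) := forall s : R, (0 <= s)%R ->
  0 <= a s /\ forall t : R, (0 <= t)%R -> (s%:E < h t) = (t%:E < a s).

(** * Profiles under cutting, flattening and dilation *)

Section Profiles.
Context (R : realType).
Implicit Types (h a : R -> \bar R).

Lemma distr_cut h a (c : R) : (0 <= c)%R -> distr h a ->
  distr (fun t => if (t < c)%R then h t else 0) (fun s => mine (a s) c%:E).
Proof.
move=> c0 ha s s0; have [a0 sa] := ha s s0; split.
  by rewrite le_min a0 lee_fin.
move=> t t0; rewrite lt_min lte_fin; case: ifP => tc.
  by rewrite sa// andbT.
by rewrite andbF lte_fin ltNge s0.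
Qed.

(** [max t c < a s] also requires [c < a s], so the distribution function drops to [0] wherever it
    does not exceed [c]. *)
Lemma distr_flat h a (c : R) : (0 <= c)%R -> distr h a ->
  distr (fun t => h (Num.max t c)) (fun s => if c%:E < a s then a s else 0).
Proof.
move=> c0 ha s s0; have [a0 sa] := ha s s0; split; first by case: ifP.
move=> t t0; rewrite sa ?le_max ?t0// EFin_max gt_max; case: ifP => ca.
  by rewrite andbT.
by rewrite andbF lte_fin ltNge t0.
Qed.

Lemma distr_half h a : distr h a ->
  distr (fun t => h (t / 2)%R) (fun s => a s + a s).
Proof.
move=> ha s s0; have [a0 sa] := ha s s0; split; first exact: adde_ge0.
move=> t t0; rewrite sa ?divr_ge0//; case: (a s) => [r| |]//=; last by rewrite !ltry.
by rewrite -EFinD !lte_fin; apply/idP/idP => ?; lra.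
Qed.

Lemma eq_ge0_lt (x y : \bar R) : 0 <= x -> 0 <= y ->
  (forall s : R, (0 <= s)%R -> (s%:E < x) = (s%:E < y)) -> x = y.
Proof.
have H (u v : \bar R) : 0 <= u -> 0 <= v ->
    (forall s : R, (0 <= s)%R -> s%:E < u -> s%:E < v) -> u <= v.
  case: u v => [u| |] [v| |]//; rewrite ?leey// => u0 v0 uv.
    rewrite leNgt; apply/negP => vu.
    by have := uv v v0 vu; rewrite ltxx.
  by have := uv v v0 (ltry _); rewrite ltxx.
move=> x0 y0 xy; apply/eqP; rewrite eq_le; apply/andP; split; apply: H => // s s0;
  by rewrite xy.
Qed.

End Profiles.

Section HalfLineDistribution.
Context d (T : measurableType d) (R : realType) (mu : {measure set T -> \bar R}).

Lemma rearrf_ge0 (u : T -> \bar R) (t : R) : 0 <= rearrf mu u t.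
Proof. by apply: le_ereal_inf_tmp => _ [s [s0 _] <-]; rewrite lee_fin. Qed.

Lemma distr_rearrf (u : T -> \bar R) : measurable_fun setT u ->
  distr (rearrf mu u) (fun s => mu [set x | s%:E < u x]).
Proof. by move=> mu_ s s0; split => // t _; exact: lt_rearrf. Qed.

Lemma rearrf_antitone (u : T -> \bar R) (t1 t2 : R) : (t1 <= t2)%R ->
  rearrf mu u t2 <= rearrf mu u t1.
Proof.
move=> t12; apply: le_ereal_inf => _ [s [s0 st] <-]; exists s => //; split => //.
by apply: le_trans st _; rewrite lee_fin.
Qed.

Lemma le_measure_ae (A B : set T) : measurable A -> measurable B ->
  {ae mu, forall x, A x -> B x} -> mu A <= mu B.
Proof.
move=> mA mB [N [mN N0 ABN]].
rewrite -[leRHS]adde0 -N0; apply: le_trans (measureU2 _ mB mN).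
apply: le_measure; rewrite ?inE//; first exact: measurableU.
move=> x Ax; have [Bx|nBx] := pselect (B x); [by left|right].
by apply: ABN => /(_ Ax).
Qed.

Lemma rearrf_le (u v : T -> \bar R) (t : R) :
  measurable_fun setT u -> measurable_fun setT v ->
  {ae mu, forall x, u x <= v x} -> rearrf mu u t <= rearrf mu v t.
Proof.
move=> mu_ mv uv; apply: le_ereal_inf => _ [s [s0 st] <-]; exists s => //.
split => //; apply: le_trans st.
apply: le_measure_ae; try exact: measurable_lt_fun.
by apply: filterS uv => x uv /= su; exact: lt_le_trans uv.
Qed.

Context (E : set T) (g : T -> R).
Context (mE : measurable E) (mg : measurable_fun setT g) (g0 : forall x, (0 <= g x)%R).
Context (muEg : forall t : R, (0 <= t)%R ->
  mu (E `&` [set x | (g x < t)%R]) = t%:E).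

Lemma measurable_lt_half_line (a : \bar R) : measurable [set x | (g x)%:E < a].
Proof.
rewrite -[X in measurable X]setTI; apply: measurable_lte => //.
exact/measurable_EFinP.
Qed.

Lemma mu_lt_half_line (a : \bar R) : 0 <= a ->
  mu (E `&` [set x | (g x)%:E < a]) = a.
Proof.
case: a => [a| |]//= a0.
  by rewrite -[RHS]muEg//; congr (mu (_ `&` _)); apply/seteqP; split => x /=; rewrite lte_fin.
apply: eq_infty => r; rewrite (@le_trans _ _ (Num.max r 0)%R%:E)//.
  by rewrite lee_fin le_max lexx.
have n0 : (0 <= Num.max r 0)%R by rewrite le_max lexx orbT.
rewrite -(muEg n0); apply: le_measure; rewrite ?inE.
- apply: measurableI => //; have := measurable_lt_half_line (Num.max r 0)%R%:E.
  by congr measurable; apply/seteqP; split => x /=; rewrite lte_fin.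
- by apply: measurableI => //; exact: measurable_lt_half_line.
- by apply: setIS => x _ /=; rewrite ltry.
Qed.

Context (h a : R -> \bar R) (ha : distr h a) (h0 : forall t, 0 <= h t).

Lemma lt_comp_distr (s : R) : (0 <= s)%R ->
  [set x | s%:E < h (g x)] = [set x | (g x)%:E < a s].
Proof.
move=> s0; apply/seteqP; split => x /=; by have [_ ->] := ha s0.
Qed.

Lemma Mplus_comp_distr : Mplus (fun x => h (g x)).
Proof.
split => //; apply: measurable_fun_ltP => // s s0.
by rewrite lt_comp_distr//; exact: measurable_lt_half_line.
Qed.

(** Taking the trace on [E] covers [sigma_map], with [E = setT], as well as the half-line maps on
    two complementary sets that serve for dilation. *)
Lemma mu_comp_distr (s : R) : (0 <= s)%R ->
  mu (E `&` [set x | s%:E < h (g x)]) = a s.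
Proof.
by move=> s0; rewrite lt_comp_distr// mu_lt_half_line//; have [] := ha s0.
Qed.

End HalfLineDistribution.

(** * Quasinorms on the positive cone *)

Section Mplus.
Context d (T : measurableType d) (R : realType).
Implicit Types (u v : T -> \bar R).

Definition pnorm (X : (T -> xcomplex R) -> \bar R) u := X (of_ereal \o u).

Lemma Mplus_add u v : Mplus u -> Mplus v -> Mplus (fun x => u x + v x).
Proof.
move=> [mu u0] [mv v0]; split; first exact: emeasurable_funD.
by move=> x; rewrite adde_ge0.
Qed.

Lemma Mplus_scale (c : \bar R) u : 0 <= c -> Mplus u -> Mplus (fun x => c * u x).
Proof.
move=> c0 [mu u0]; split; last by move=> x; rewrite mule_ge0.
exact: (emeasurable_funM (@measurable_cst _ _ _ _ setT c) mu).
Qed.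

Lemma Mplus_indic (A : set T) : measurable A -> Mplus (fun x => (\1_A x)%:E : \bar R).
Proof.
move=> mA; split; last by move=> x; rewrite lee_fin.
exact/measurable_EFinP.
Qed.

Lemma Mplus_if (A : set T) u : measurable A -> Mplus u ->
  Mplus (fun x => if x \in A then u x else 0).
Proof.
move=> mA [mu u0]; split; last by move=> x; case: ifP.
apply: measurable_fun_ltP => [x|s s0]; first by case: ifP.
rewrite (_ : [set x | _] = A `&` [set x | s%:E < u x]).
  by apply: measurableI => //; exact: measurable_lt_fun.
apply/seteqP; split => x /=.
  by case: ifPn => [/set_mem Ax ?|_]; [split|rewrite lte_fin ltNge s0].
by move=> [Ax]; rewrite mem_set.
Qed.

Lemma xmeasurable_of_ereal u : Mplus u -> xmeasurable (fun x => of_ereal (u x)).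
Proof.
move=> [mu u0]; split.
- rewrite (_ : [set x | _] = u @^-1` [set +oo]).
    by rewrite -[X in measurable X]setTI; apply: mu => //; exact: emeasurable_set1.
  by apply/seteqP; split => x /=; have := u0 x; case: (u x) => [r| |].
- rewrite (_ : (fun x => _) = fine \o u); last first.
    by apply/funext => x /=; case: (u x).
  exact: measurableT_comp.
- rewrite (_ : (fun x => _) = cst 0%R)//.
  by apply/funext => x /=; case: (u x).
Qed.

Lemma Mplus_xmod (f : T -> xcomplex R) : xmeasurable f -> Mplus (fun x => xmod (f x)).
Proof.
move=> [mI mRe mIm]; split; last by move=> x; exact: xmod_ge0.
apply: measurable_fun_ltP => [x|s s0]; first exact: xmod_ge0.
pose q x := (xRe (f x) ^+ 2 + xIm (f x) ^+ 2)%R.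
have mq : measurable_fun setT q.
  by apply: measurable_funD; apply: measurable_funX.
rewrite (_ : [set x | _] = [set x | f x = XInf] `|` q @^-1` `](s ^+ 2)%R, +oo[).
  apply: measurableU => //; rewrite -[X in measurable X]setTI.
  by apply: mq => //; exact: measurable_itv.
rewrite preimage_itvoy; apply/seteqP; split => x /=; rewrite /q.
  case: (f x) => [[a b]|] /=; last by left.
  rewrite lte_fin -(@ltr_pXn2r _ 2)// ?nnegrE ?sqrtr_ge0//.
  by rewrite sqr_sqrtr ?addr_ge0 ?sqr_ge0//; right.
move=> [->|]; first by rewrite ltry.
case: (f x) => [[a b]|] /=; last by rewrite ltry.
rewrite lte_fin -[in X in _ -> X](@ltr_pXn2r _ 2)// ?nnegrE ?sqrtr_ge0//.
by rewrite sqr_sqrtr ?addr_ge0 ?sqr_ge0.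
Qed.

End Mplus.

Section RiNorm.
Context d (T : measurableType d) (R : realType) (mu : {measure set T -> \bar R}).
Context (na : nonatomic mu) (sf : sigma_finite setT mu) (muT : mu setT = +oo).
Implicit Types (X Y : (T -> xcomplex R) -> \bar R) (u v : T -> \bar R).

Let g : T -> R := sigma_map mu.

Lemma sigma_map_measurable : measurable_fun setT g.
Proof. by have [] := sigma_mapP na sf muT. Qed.

Lemma sigma_map_ge0 x : (0 <= g x)%R.
Proof. by have [_ H _] := sigma_mapP na sf muT; exact: H. Qed.

Lemma sigma_map_lt (t : R) : (0 <= t)%R -> mu (setT `&` [set x | (g x < t)%R]) = t%:E.
Proof.
move=> t0; rewrite setTI; have [_ _ /(_ (`]-oo, t[%classic : set R))] := sigma_mapP na sf muT.
move=> /(_ _)H; rewrite -(lambda_ltr t0) -H; last exact: measurable_itv.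
by rewrite preimage_itvNyo.
Qed.

Lemma Mplus_comp (h a : R -> \bar R) : distr h a -> (forall t, 0 <= h t) ->
  Mplus (fun x => h (g x)).
Proof. exact: Mplus_comp_distr sigma_map_measurable sigma_map_ge0 _ _. Qed.

Lemma mu_comp (h a : R -> \bar R) (s : R) : distr h a -> (0 <= s)%R ->
  mu [set x | s%:E < h (g x)] = a s.
Proof.
move=> ha s0; rewrite -[X in mu X]setTI.
exact: (mu_comp_distr measurableT sigma_map_measurable sigma_map_ge0 sigma_map_lt ha s0).
Qed.

Lemma Mplus_rearrf u : measurable_fun setT u -> Mplus (fun x => rearrf mu u (g x)).
Proof. by move=> mu_; apply: Mplus_comp (distr_rearrf mu mu_) _ => t; exact: rearrf_ge0. Qed.

Lemma pnorm_equidist X u v : ri_qbf_norm mu X -> Mplus u -> Mplus v ->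
  (forall s : R, (0 <= s)%R -> mu [set x | s%:E < u x] = mu [set x | s%:E < v x]) ->
  pnorm X u = pnorm X v.
Proof.
move=> HX Mu Mv uv; apply: (qbfn_ri HX); try exact: xmeasurable_of_ereal.
have E w (s : R) : Mplus w ->
    [set x | s%:E < xmod ((of_ereal \o w) x)] = [set x | s%:E < w x].
  by move=> [_ w0]; apply/seteqP; split => x /=; rewrite xmod_of_ereal.
move=> t t0; congr ereal_inf; congr image; apply/seteqP; split => s /= [s0];
  by rewrite !E// uv.
Qed.

End RiNorm.

Section PositiveCone.
Context d (T : measurableType d) (R : realType) (mu : {measure set T -> \bar R}).
Implicit Types (X Y : (T -> xcomplex R) -> \bar R) (u v : T -> \bar R).

Lemma xscale_of_ereal (c : R) (r : \bar R) : (0 <= c)%R -> 0 <= r ->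
  xscale (Complex c 0%R) (of_ereal r) = of_ereal (c%:E * r).
Proof.
move=> c0; case: r => [r| |] //= r0.
  congr XFin; apply/eqP; rewrite eq_complex /=.
  by rewrite !mulr0 mul0r subr0 addr0 !eqxx.
have [->|cn0] := eqVneq c 0%R; first by rewrite mul0e ifT//; exact: eqxx.
rewrite gt0_muley ?lte_fin ?lt_neqAle 1?eq_sym ?cn0// ifF//.
by apply: contra_neqF cn0 => /eqP/(congr1 (@complex.Re R)).
Qed.

Context X (HX : ri_qbf_norm mu X).

Lemma pnorm_ge0 u : Mplus u -> 0 <= pnorm X u.
Proof. by move=> Mu; apply: (qbfn_ge0 HX); exact: xmeasurable_of_ereal. Qed.

Lemma pnorm_xmod f : xmeasurable f -> pnorm X (fun x => xmod (f x)) = X f.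
Proof. exact: (qbfn_mod HX). Qed.

Lemma pnorm_scale (c : R) u : (0 <= c)%R -> Mplus u ->
  pnorm X (fun x => c%:E * u x) = c%:E * pnorm X u.
Proof.
move=> c0 Mu; have := qbfn_scale HX (Complex c 0%R) Mu.
rewrite /= expr0n /= addr0 sqrtr_sqr ger0_norm// => <-.
by congr X; apply/funext => x /=; rewrite xscale_of_ereal//; have [_ ->] := Mu.
Qed.

Lemma pnorm_le u v : Mplus u -> Mplus v -> (forall x, u x <= v x) ->
  pnorm X u <= pnorm X v.
Proof. by move=> Mu Mv uv; apply: (qbfn_lattice HX) => //; exact: aeW. Qed.

Lemma pnorm_triangle : exists K : R, (1 <= K)%R /\
  forall u v, Mplus u -> Mplus v ->
    pnorm X (fun x => u x + v x) <= K%:E * (pnorm X u + pnorm X v).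
Proof. exact: qbfn_triangle HX. Qed.

Lemma pnorm_indic_fin (A : set T) : measurable A -> mu A < +oo ->
  pnorm X (fun x => (\1_A x)%:E) < +oo.
Proof. exact: (qbfn_indic HX). Qed.

Lemma pnorm_indic_gt0 (A : set T) : measurable A -> 0 < mu A ->
  0 < pnorm X (fun x => (\1_A x)%:E).
Proof.
move=> mA A0; rewrite lt0e pnorm_ge0 ?andbT; last exact: Mplus_indic.
apply/eqP => /(qbfn_eq0 HX (Mplus_indic _ mA)) A_ae0.
suff : mu A <= mu set0 by rewrite measure0 leNgt A0.
apply: le_measure_ae => //; apply: filterS A_ae0 => x /= + Ax.
by rewrite indicE mem_set// => /eqP; rewrite onee_eq0.
Qed.

(** The norm dominates every real multiple of the positive norm of the indicator. This is how
    finiteness of a norm is turned into finiteness of values. *)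
Lemma pnorm_scaleoo (A : set T) : measurable A -> 0 < mu A ->
  pnorm X (fun x => +oo * (\1_A x)%:E) = +oo.
Proof.
move=> mA A0; have MA := Mplus_indic R mA.
apply: eq_infty => r; have := pnorm_indic_gt0 mA A0.
have le_oo (c : R) : (0 <= c)%R -> c%:E * pnorm X (fun x => (\1_A x)%:E) <=
    pnorm X (fun x => +oo * (\1_A x)%:E).
  move=> c0; rewrite -pnorm_scale//; apply: pnorm_le => [||x].
  - exact: Mplus_scale.
  - exact: Mplus_scale.
  - by rewrite lee_wpmul2r ?leey ?lee_fin.
case E : (pnorm X (fun x => (\1_A x)%:E)) => [b| |] // b0.
  have r0 : (0 <= Num.max r 0)%R by rewrite le_max lexx orbT.
  rewrite (@le_trans _ _ (Num.max r 0)%R%:E) ?lee_fin ?le_max ?lexx//.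
  rewrite lte_fin in b0.
  have := le_oo (Num.max r 0 / b)%R; rewrite divr_ge0 ?(ltW b0)// => /(_ isT).
  by rewrite E -EFinM divfK// gt_eqF.
by have := le_oo 1%R; rewrite E mul1e leye_eq => /(_ ler01)/eqP ->; rewrite leey.
Qed.

End PositiveCone.

(** * Comparison of two quasinorms *)

Section Compare.
Context d (T : measurableType d) (R : realType) (mu : {measure set T -> \bar R}).
Implicit Types (X Y : (T -> xcomplex R) -> \bar R) (u v : T -> \bar R).

(** For finite [c] both sides are multiples of [c], so the ratio of the norms of the indicators
    serves; adding [1] keeps [C] positive when [A] is null. For [c = +oo] the right-hand side is
    infinite. *)
Lemma pnorm_indic_compare X Y (A B : set T) : ri_qbf_norm mu X -> ri_qbf_norm mu Y ->
  measurable A -> mu A < +oo -> measurable B -> 0 < mu B -> mu B < +oo ->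
  exists C : R, (0 < C)%R /\ forall c : \bar R, 0 <= c ->
    pnorm X (fun x => c * (\1_A x)%:E) <= C%:E * pnorm Y (fun x => c * (\1_B x)%:E).
Proof.
move=> HX HY mA Aoo mB B0 Boo.
have := pnorm_indic_fin HX mA Aoo; have := pnorm_ge0 HX (Mplus_indic R mA).
have := pnorm_indic_fin HY mB Boo; have := pnorm_indic_gt0 HY mB B0.
case EB : (pnorm Y _) => [b| |]//; rewrite lte_fin => b0 _.
case EA : (pnorm X _) => [a| |]//; rewrite lee_fin => a0 _.
have C0 : (0 < a / b + 1)%R by rewrite ltr_wpDl// divr_ge0// ltW.
exists (a / b + 1)%R; split => // -[c| |] // c0; last first.
  by rewrite (pnorm_scaleoo HY mB B0) gt0_muley ?lte_fin// leey.
rewrite (pnorm_scale HX)//; last exact: Mplus_indic.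
rewrite (pnorm_scale HY)//; last exact: Mplus_indic.
rewrite EA EB -!EFinM !lee_fin in c0 *.
rewrite mulrCA ler_wpM2l// mulrDl mul1r divfK ?gt_eqF//.
by rewrite lerDl ltW.
Qed.

Lemma pnorm_eq0 X : ri_qbf_norm mu X -> pnorm X (fun=> 0) = 0.
Proof.
move=> HX; apply/(qbfn_eq0 HX); last exact: aeW.
by split => //; exact: measurable_cst.
Qed.

(* Summing counterexamples to the inequality, scaled so that the [X]-norms decay
   geometrically, would give an element of [D] violating the inclusion. *)
Lemma inclusion_bound X Y (D : (T -> \bar R) -> Prop) :
  ri_qbf_norm mu X -> ri_qbf_norm mu Y ->
  (forall u, D u -> Mplus u) ->
  (forall u (c : R), D u -> (0 < c)%R -> D (fun x => c%:E * u x)) ->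
  (forall u_ : nat -> T -> \bar R, (forall n, D (u_ n)) ->
     D (fun x => \sum_(0 <= n <oo) u_ n x)) ->
  (forall u, D u -> pnorm X u < +oo -> pnorm Y u < +oo) ->
  exists C : R, (0 < C)%R /\ forall u, D u -> pnorm Y u <= C%:E * pnorm X u.
Proof.
move=> HX HY DM DZ DS XY; have [K [K1 XK]] := pnorm_triangle HX.
have q0 : (0 < (2 * K)^-1)%R by rewrite invr_gt0; lra.
(* This ratio absorbs the constant of the triangle inequality:
   [K * (q ^+ m.+1 + q ^+ m.+1) = q ^+ m], so a block of humps starting at [m] has norm at most
   [q ^+ m]. *)
set q := ((2 * K)^-1)%R in q0.
apply: contrapT => /forallNP noC.
have bad n : exists v, [/\ D v, pnorm X v <= (q ^+ n.+1)%:E & n.+1%:R%:E <= pnorm Y v].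
  pose c : R := (n.+1%:R / q ^+ n.+1)%R.
  have c0 : (0 < c)%R by rewrite divr_gt0// exprn_gt0.
  have /not_andP[//|/existsNP[u /not_implyP[Du /negP]]] := noC c.
  rewrite -ltNge => uc.
  have X0 := pnorm_ge0 HX (DM _ Du).
  have Xfin : pnorm X u \is a fin_num.
    rewrite ge0_fin_numE// ltNge leye_eq; apply/negP => /eqP Xoo.
    by move: uc; rewrite Xoo gt0_muley ?lte_fin// ltNge leey.
  (* [y] is a finite substitute for the [Y]-norm of [u], which may be infinite. Scaling [u] by
     [n.+1 / y] lifts the [Y]-norm to at least [n.+1] and, by the choice of [c], keeps the [X]-norm
     below [q ^+ n.+1]. *)
  have [y [y0 Xy yY]] : exists y : R, [/\ (0 < y)%R, c%:E * pnorm X u <= y%:E &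
      y%:E <= pnorm Y u].
    have cX0 : 0 <= c%:E * pnorm X u by rewrite mule_ge0// lee_fin ltW.
    case: (pnorm Y u) uc => [y| |] uc; last by rewrite ltNge leNye in uc.
      exists y; split => //; last exact: ltW.
      by rewrite -lte_fin (le_lt_trans cX0).
    exists (c * fine (pnorm X u) + 1)%R; split; rewrite ?leey//.
      by rewrite ltr_wpDl// mulr_ge0 ?(ltW c0)// fine_ge0.
    by rewrite -(fineK Xfin) -EFinM lee_fin lerDl.
  have z0 : (0 < n.+1%:R / y)%R by rewrite divr_gt0.
  exists (fun x => (n.+1%:R / y)%:E * u x); split; first exact: DZ.
    rewrite (pnorm_scale HX) ?(ltW z0)//; last exact: DM.
    rewrite -(fineK Xfin) -!EFinM !lee_fin in Xy *.
    move: Xy; rewrite /c mulrAC ler_pdivrMr ?exprn_gt0// => Xy.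
    by rewrite mulrAC ler_pdivrMr// [leRHS]mulrC.
  rewrite (pnorm_scale HY) ?(ltW z0)//; last exact: DM.
  rewrite -lee_pdivrMl// invf_div -EFinM divfK ?pnatr_eq0//.
have [v vP] := choice bad.
have Mv n : Mplus (v n) by apply: DM; have [] := vP n.
have Msum m n : Mplus (fun x => \sum_(m <= i < n) v i x).
  split; last by move=> x; apply: sume_ge0 => i _; have [_ ->] := Mv i.
  by apply: emeasurable_sum => i; have [] := Mv i.
have partial k m : pnorm X (fun x => \sum_(m <= i < m + k) v i x) <= (q ^+ m)%:E.
  elim: k m => [|k IH] m.
    rewrite (_ : (fun x => _) = fun=> 0) ?pnorm_eq0 ?lee_fin ?exprn_ge0 ?(ltW q0)//.
    by apply/funext => x; rewrite addn0 big_geq.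
  rewrite (_ : (fun x => _) = fun x => v m x + \sum_(m.+1 <= i < m.+1 + k) v i x).
    have [_ vm _] := vP m.
    apply: le_trans (XK _ _ (Mv m) (Msum _ _)) _.
    rewrite (@le_trans _ _ (K%:E * ((q ^+ m.+1)%:E + (q ^+ m.+1)%:E)))//.
      by rewrite lee_wpmul2l ?lee_fin ?(le_trans ler01)// leeD.
    rewrite -EFinD -EFinM lee_fin exprS -mulr2n -mulrnAr mulrA -mulr_natl.
    rewrite [X in (X <= _)%R](_ : _ = (2 * K * q) * q ^+ m)%R; last by ring.
    by rewrite mulfV ?mul1r// gt_eqF//; lra.
  by apply/funext => x; rewrite addnS -addSn big_ltn// ltn_addr.
pose w x := \sum_(0 <= n <oo) v n x.
have Dw : D w by apply: DS => n; have [] := vP n.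
pose S n x := \sum_(0 <= i < n) v i x.
have Sae : {ae mu, forall x, (forall n, S n x <= S n.+1 x) /\ S ^~ x @ \oo --> w x}.
  apply: aeW => x; split; last first.
    by apply: is_cvg_nneseries => n _ _; have [_ ->] := Mv n.
  by move=> n; rewrite /S big_nat_recr//= leeDl//; have [_ ->] := Mv n.
have [_ Scvg] := qbfn_fatou HX (Msum 0%N) (DM _ Dw) Sae.
(* By the Fatou property the bound [q ^+ 0 = 1] on partial sums passes to [w], whereas [w] dominates
   every hump and so has [Y]-norm at least [n.+1] for all [n]. *)
have Xw : pnorm X w < +oo.
  apply: (@le_lt_trans _ _ 1%E); last exact: ltry.
  rewrite /pnorm -(cvg_lim _ Scvg)//.
  apply: lime_le; first by apply/cvg_ex; eexists; exact: Scvg.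
  by near=> n; rewrite -[1%E]/((q ^+ 0)%:E); exact: (partial n 0%N).
have := XY _ Dw Xw; apply/negP; rewrite -leNgt leye_eq; apply/eqP.
apply: eq_infty => r.
rewrite (@le_trans _ _ (Num.trunc `|r|%R).+1%:R%:E)//.
  rewrite lee_fin (le_trans (ler_norm r))// ltW//.
  by have /andP[] := truncn_itv (normr_ge0 r).
have [_ _] := vP (Num.trunc `|r|%R); move/le_trans; apply.
apply: (pnorm_le HY) => //; first exact: DM.
move=> x; apply: le_trans (nneseries_lim_ge (Num.trunc `|r|%R).+1 _) => /=; last first.
  by move=> i _ _; have [_ ->] := Mv i.
by rewrite big_nat_recr//= leeDr// sume_ge0// => i _; have [_ ->] := Mv i.
Unshelve. all: by end_near.
Qed.

End Compare.

(** * Domination and dilation *)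

Section Restriction.
Context d (T : measurableType d) (R : realType) (mu : {measure set T -> \bar R}).
Context (na : nonatomic mu) (sf : sigma_finite setT mu).

(** The restriction of [mu] to [E] is again non-atomic, sigma-finite and of infinite mass, so the
    construction on the whole space applies to it. *)
Lemma half_line_map_on (E : set T) : measurable E -> mu E = +oo ->
  exists s : T -> R, [/\ measurable_fun setT s, forall x, (0 <= s x)%R &
    forall t : R, (0 <= t)%R -> mu (E `&` [set x | (s x < t)%R]) = t%:E].
Proof.
move=> mE Eoo.
have naE : nonatomic (mrestr mu mE).
  move=> A mA A0; have [F [mF FA F0 FAl]] := na (measurableI _ _ mA mE) A0.
  have FE : F `&` E = F by rewrite setIidl// => x /FA[].
  exists F; split => //; first by move=> x /FA[].
    by change (0 < mu (F `&` E)); rewrite FE.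
  by change (mu (F `&` E) < mu (A `&` E)); rewrite FE.
have sfE : sigma_finite setT (mrestr mu mE).
  have [F FT FP] := sf; exists F => // i; have [mF Foo] := FP i; split => //.
  apply: le_lt_trans Foo; apply: le_measure; rewrite ?inE//.
  exact: measurableI.
have [|s [ms s0 smu]] := half_line_map naE sfE.
  by change (mu (setT `&` E) = +oo); rewrite setTI.
by exists s; split => // t t0; rewrite setIC; exact: smu.
Qed.

End Restriction.

Section Domination.
Context d (T : measurableType d) (R : realType) (mu : {measure set T -> \bar R}).
Context (na : nonatomic mu) (sf : sigma_finite setT mu) (muT : mu setT = +oo).
Implicit Types (X Y : (T -> xcomplex R) -> \bar R) (u v : T -> \bar R).

Let g : T -> R := sigma_map mu.

Lemma pnorm_rearrf X u : ri_qbf_norm mu X -> Mplus u ->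
  pnorm X (fun x => rearrf mu u (g x)) = pnorm X u.
Proof.
move=> HX [mu_ u0]; apply: (pnorm_equidist HX) => //.
  exact: (Mplus_rearrf na sf muT).
by move=> s s0; rewrite (mu_comp na sf muT (distr_rearrf mu mu_)).
Qed.

(** Domination of distribution functions becomes pointwise domination once both functions are
    replaced by their rearrangements composed with [sigma_map]. *)
Lemma pnorm_dom X u v : ri_qbf_norm mu X -> Mplus u -> Mplus v ->
  (forall s : R, (0 <= s)%R -> mu [set x | s%:E < u x] <= mu [set x | s%:E < v x]) ->
  pnorm X u <= pnorm X v.
Proof.
move=> HX Mu Mv uv; rewrite -(pnorm_rearrf HX Mu) -(pnorm_rearrf HX Mv).
apply: (pnorm_le HX).
- by apply: (Mplus_rearrf na sf muT); have [] := Mu.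
- by apply: (Mplus_rearrf na sf muT); have [] := Mv.
move=> x; apply: le_ereal_inf => _ [s [s0 st] <-]; exists s => //; split => //.
exact: le_trans (uv s s0) st.
Qed.

(** The preimages of the intervals [[n, n+1[] under [sigma_map] are disjoint of measure [1]. The
    even ones make up [E], and the odd ones lie in its complement. *)
Lemma infinite_halves : exists E : set T,
  [/\ measurable E, mu E = +oo & mu (~` E) = +oo].
Proof.
have [mg g0 gP] := sigma_mapP na sf muT.
pose F n := g @^-1` `[n%:R, n.+1%:R[.
have mF n : measurable (F n).
  by rewrite -[X in measurable X]setTI; apply: mg => //; exact: measurable_itv.
have muF n : mu (F n) = 1.
  rewrite (gP (`[n%:R, n.+1%:R[%classic : set R)); last exact: measurable_itv.
  rewrite lambdaE setIidl.
    by rewrite lebesgue_measure_itv /= lte_fin ltr_nat leqnn -EFinB -natr1 addrC addKr.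
  by move=> x /=; rewrite !in_itv /= andbT => /andP[nx _]; exact: le_trans nx.
have Fdisj n m x : F n x -> F m x -> n = m.
  rewrite /F /= !in_itv /= => /andP[nx xn] /andP[mx xm].
  by apply/eqP; rewrite eqn_leq -[(n <= m)%N]ltnS -[(m <= n)%N]ltnS -!(ltr_nat R)
    (le_lt_trans nx xm) (le_lt_trans mx xn).
have big (f : nat -> nat) (A : set T) : injective f -> measurable A ->
    (forall n, F (f n) `<=` A) -> mu A = +oo.
  move=> finj mA FA; apply: eq_infty => r.
  pose N := (Num.trunc `|r|%R).+1.
  rewrite (@le_trans _ _ N%:R%:E)//.
    rewrite lee_fin (le_trans (ler_norm r))// ltW//.
    by have /andP[] := truncn_itv (normr_ge0 r).
  have tF : trivIset setT (fun n => F (f n)).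
    by apply/trivIsetP => i j _ _ ij; apply/seteqP; split => // x [/= Fi Fj];
      move: ij; rewrite (finj _ _ (Fdisj _ _ _ Fi Fj)) eqxx.
  have <- : mu (\big[setU/set0]_(i < N) F (f i)) = N%:R%:E.
    rewrite (@measure_semi_additive_ord_I _ _ _ mu (fun n => F (f n)))//.
    - rewrite (eq_bigr (fun=> 1%:E)); last by move=> i _; exact: muF.
      by rewrite sumEFin sumr_const card_ord.
    - exact: sub_trivIset tF.
    - exact: bigsetU_measurable.
  apply: le_measure; rewrite ?inE//; first exact: bigsetU_measurable.
  by move=> x; rewrite -(bigcup_mkord N (fun n => F (f n))) => -[i _]; exact: FA.
pose E := \bigcup_n F n.*2.
have mE : measurable E by exact: bigcupT_measurable.
exists E; split => //.
  apply: (big double) => //; first exact: double_inj.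
  by move=> n x Fx; exists n.
apply: (big (fun n => n.*2.+1)); first by move=> i j [] /double_inj.
  exact: measurableC.
move=> n x Fx [m _ /(Fdisj _ _ _ Fx) /(congr1 odd)].
by rewrite /= !odd_double.
Qed.

(* [h(g/2)] is equidistributed with the sum of two copies of [h(g)] carried by
   disjoint sets of infinite measure. *)
Lemma dilation_bound X : ri_qbf_norm mu X -> exists C : R, (0 < C)%R /\
  forall h a : R -> \bar R, distr h a -> (forall t, 0 <= h t) ->
    pnorm X (fun x => h (g x / 2)%R) <= C%:E * pnorm X (fun x => h (g x)).
Proof.
move=> HX; have [E [mE Eoo ECoo]] := infinite_halves.
have [s1 [ms1 s10 s1P]] := half_line_map_on na sf mE Eoo.
have [s2 [ms2 s20 s2P]] := half_line_map_on na sf (measurableC mE) ECoo.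
have [K [K1 XK]] := pnorm_triangle HX.
(* One [K] for each of the two copies, both of which have the distribution of [h] composed with
   [g]. *)
exists (K + K)%R; split; first by lra.
move=> h a ha h0.
have Mg := Mplus_comp na sf muT ha h0.
pose v1 x := if x \in E then h (s1 x) else 0.
pose v2 x := if x \in ~` E then h (s2 x) else 0.
have Mv1 : Mplus v1 by apply: Mplus_if => //; exact: (Mplus_comp_distr ms1 s10 ha h0).
have Mv2 : Mplus v2.
  by apply: Mplus_if; [exact: measurableC|exact: (Mplus_comp_distr ms2 s20 ha h0)].
have v1E (s : R) : (0 <= s)%R -> [set x | s%:E < v1 x] = E `&` [set x | s%:E < h (s1 x)].
  move=> s0; apply/seteqP; split => x; rewrite /v1 /=.
    by case: ifPn => [/set_mem|_]; [split|rewrite lte_fin ltNge s0].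
  by move=> [Ex ?]; rewrite mem_set.
have v2E (s : R) : (0 <= s)%R -> [set x | s%:E < v2 x] = ~` E `&` [set x | s%:E < h (s2 x)].
  move=> s0; apply/seteqP; split => x; rewrite /v2 /=.
    by case: ifPn => [/set_mem|_]; [split|rewrite lte_fin ltNge s0].
  by move=> [Ex ?]; rewrite mem_set.
have muv1 (s : R) : (0 <= s)%R -> mu [set x | s%:E < v1 x] = a s.
  by move=> s0; rewrite v1E// (mu_comp_distr mE ms1 s10 s1P ha).
have muv2 (s : R) : (0 <= s)%R -> mu [set x | s%:E < v2 x] = a s.
  by move=> s0; rewrite v2E// (mu_comp_distr (measurableC mE) ms2 s20 s2P ha).
have h2 := distr_half ha.
have M2 := Mplus_comp na sf muT h2 (fun t => h0 _).
have -> : pnorm X (fun x => h (g x / 2)%R) = pnorm X (fun x => v1 x + v2 x).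
  apply: (pnorm_equidist HX) => //; first exact: Mplus_add.
  move=> s s0; rewrite (mu_comp na sf muT h2)//.
  have -> : [set x | s%:E < v1 x + v2 x] =
      [set x | s%:E < v1 x] `|` [set x | s%:E < v2 x].
    apply/seteqP; split => x; rewrite /v1 /v2 /=.
      case: ifPn => [Ex|nEx].
        by rewrite ifF ?adde0; [left|rewrite in_setC Ex].
      by rewrite in_setC nEx add0e; right.
    case: ifPn => [Ex|nEx]; rewrite in_setC ?Ex ?nEx /= ?adde0 ?add0e.
      by move=> [//|]; rewrite lte_fin ltNge s0.
    by move=> [|//]; rewrite lte_fin ltNge s0.
  rewrite -{1}(muv1 _ s0) -(muv2 _ s0) measureU//.
  - by apply: measurable_lt_fun; case: Mv1.
  - by apply: measurable_lt_fun; case: Mv2.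
  - by rewrite v1E// v2E//; apply/seteqP; split => // x [[Ex _] [nEx _]].
apply: le_trans (XK _ _ Mv1 Mv2) _.
have K0 : 0 <= K%:E by rewrite lee_fin (le_trans ler01).
rewrite EFinD ge0_muleDl// ge0_muleDr ?(pnorm_ge0 HX)//.
by apply: leeD; apply: lee_wpmul2l => //; apply: (pnorm_dom HX) => // s s0;
  rewrite ?muv1 ?muv2// (mu_comp na sf muT ha).
Qed.

End Domination.

(** * Local and global components *)

Section Components.
Context d (T : measurableType d) (R : realType) (mu : {measure set T -> \bar R}).
Context (na : nonatomic mu) (sf : sigma_finite setT mu) (muT : mu setT = +oo).
Implicit Types (X Y : (T -> xcomplex R) -> \bar R) (u v : T -> \bar R).

Let g : T -> measurableTypeR R := sigma_map mu.
Let mg : measurable_fun setT g. Proof. by have [] := sigma_mapP na sf muT. Qed.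
Let g0 x : (0 <= (g x : R))%R. Proof. exact: sigma_map_ge0 na sf muT x. Qed.

(** [k] need not be monotone: [g] is measure preserving, so [k] composed with [g] is equidistributed
    with the rearrangement of [k] composed with [g]. *)
Lemma canonical_normE X (k : measurableTypeR R -> \bar R) : ri_qbf_norm mu X ->
  Mplus k -> canonical_norm mu X (fun t => of_ereal (k t)) = pnorm X (fun x => k (g x)).
Proof.
move=> HX Mk; have [mk k0] := Mk.
have -> : canonical_norm mu X (fun t => of_ereal (k t)) =
    pnorm X (fun x => rearrf (lambda R) k (g x)).
  rewrite /canonical_norm /pnorm; congr X; apply/funext => x /=; congr of_ereal.
  rewrite /rearr /rearrf; congr ereal_inf; congr image; apply/seteqP.
  have E s : [set t | s%:E < xmod (of_ereal (k t))] = [set t | s%:E < k t].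
    by apply/seteqP; split => t /=; rewrite xmod_of_ereal.
  by split => s /= [s0]; rewrite E.
have dk := distr_rearrf (lambda R) mk.
apply: (pnorm_equidist HX).
- by apply: (Mplus_comp na sf muT dk) => t; exact: rearrf_ge0.
- by split => //; exact: measurableT_comp.
move=> s s0; rewrite (mu_comp na sf muT dk)//.
have [_ _ gP] := sigma_mapP na sf muT.
by rewrite -gP//; exact: measurable_lt_fun.
Qed.

Lemma Mplus_rearrf_half_line u : measurable_fun setT u ->
  Mplus (rearrf mu u : measurableTypeR R -> \bar R).
Proof.
move=> mu_; split; last by move=> t; exact: rearrf_ge0.
apply: measurable_fun_ltP => [t|s s0]; first exact: rearrf_ge0.
rewrite (_ : [set t | _] = [set t : measurableTypeR R | (t : R)%:E < mu [set x | s%:E < u x]]).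
  exact: (measurable_lt_half_line (@measurable_id _ _ _)).
by apply/seteqP; split => t /=; rewrite lt_rearrf.
Qed.

Lemma rearr_rearrf u (t : R) : measurable_fun setT u ->
  rearr (lambda R) (fun t => of_ereal (rearrf mu u t)) t = rearrf mu u t.
Proof.
move=> mu_; congr ereal_inf; congr image; apply/seteqP.
have E (s : R) : (0 <= s)%R ->
    lambda R [set t | s%:E < xmod (of_ereal (rearrf mu u t))] = mu [set x | s%:E < u x].
  move=> s0; rewrite (_ : [set t | _] = [set t | s%:E < rearrf mu u t]); last first.
    by apply/seteqP; split => r /=; rewrite xmod_of_ereal ?rearrf_ge0.
  have [_ _ gP] := sigma_mapP na sf muT.
  rewrite -gP; last by apply: measurable_lt_fun; case: (Mplus_rearrf_half_line mu_).
  exact: (mu_comp na sf muT (distr_rearrf mu mu_)).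
by split => s /= [s0]; rewrite E.
Qed.

(** The component hypotheses concern functions on the half-line. Applied to [rearrf mu u], which is
    its own rearrangement, they become statements about norms on [T]. *)
Lemma canonical_norm_rearr_on X u (I : set R) : ri_qbf_norm mu X -> Mplus u ->
  measurable I ->
  canonical_norm mu X (rearr_on (fun t => of_ereal (rearrf mu u t)) I) =
  pnorm X (fun x => rearrf mu u (g x) * (\1_I (g x))%:E).
Proof.
move=> HX [mu_ u0] mI.
rewrite -(@canonical_normE X (fun t => rearrf mu u t * (\1_I t)%:E)) //.
  congr (canonical_norm mu X); apply/funext => t.
  by rewrite /rearr_on rearr_rearrf.
have [mr r0] := Mplus_rearrf_half_line mu_.
have [mi i0] := @Mplus_indic _ (measurableTypeR R) R I mI.
split; first exact: emeasurable_funM.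
by move=> t; rewrite mule_ge0// ?r0 ?i0.
Qed.

Let lt1 := [set x : T | ((g x : R) < 1)%R].

Let mlt1 : measurable lt1.
Proof.
rewrite /lt1 -preimage_itvNyo -[X in measurable X]setTI.
by apply: mg => //; exact: measurable_itv.
Qed.

Let mult1 : mu lt1 = 1.
Proof. by have := sigma_map_lt na sf muT ler01; rewrite setTI. Qed.

(** Monotonicity is not asked for: vanishing off a set of measure [1] already makes the
    rearrangement vanish from [1] on. *)
Definition local_profile u : Prop := Mplus u /\ forall x, (1 <= (g x : R))%R -> u x = 0.

(** The constant [c] is extended real because a countable sum of such profiles, whose constants are
    summed, may have an infinite one. *)
Definition global_profile u : Prop := Mplus u /\
  exists c : \bar R, [/\ 0 <= c, forall x, u x <= c & forall x, ((g x : R) < 1)%R -> u x = c].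

Lemma canonical_norm_local X u : ri_qbf_norm mu X -> local_profile u ->
  canonical_norm mu X (rearr_on (fun t => of_ereal (rearrf mu u t)) `[0%R, 1%R]) =
  pnorm X u.
Proof.
move=> HX [Mu uout]; rewrite (canonical_norm_rearr_on HX Mu (measurable_itv `[0%R, 1%R])).
rewrite -(pnorm_rearrf na sf muT HX Mu); congr pnorm; apply/funext => x.
rewrite indicE; have [_|gx] := boolP (_ \in _); first by rewrite mule1.
rewrite mule0; apply/esym/eqP; rewrite eq_le rearrf_ge0 andbT leNgt.
have [mu_ _] := Mu; rewrite lt_rearrf// -leNgt.
have : (1 <= (g x : R))%R.
  rewrite leNgt; apply: contra gx => gx1; rewrite inE /= in_itv /= g0.
  exact: ltW.
rewrite -lee_fin; apply: le_trans; rewrite -mult1.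
apply: le_measure; rewrite ?inE//; first exact: measurable_lt_fun.
move=> y /= uy; rewrite /lt1 /= ltNge; apply/negP => /uout uy0.
by rewrite uy0 ltxx in uy.
Qed.

Lemma local_bound X Y : ri_qbf_norm mu X -> ri_qbf_norm mu Y ->
  local_component_stronger mu X Y ->
  exists C : R, (0 < C)%R /\ forall u, local_profile u -> pnorm Y u <= C%:E * pnorm X u.
Proof.
move=> HX HY XY; apply: (inclusion_bound HX HY).
- by move=> u [].
- move=> u c [Mu uout] c0; split => [|x gx].
    by apply: Mplus_scale => //; rewrite lee_fin ltW.
  by rewrite uout// mule0.
- move=> u_ Du; split => [|x gx]; last first.
    by apply: eseries0 => n _ _; have [_ ->] := Du n.
  split; last first.
    by move=> x; apply: nneseries_ge0 => n _ _; have [[_ ->]] := Du n.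
  apply: (ge0_emeasurable_sum (P := xpredT)) => [n x _ _|n _].
    by have [[_ ->]] := Du n.
  by have [[]] := Du n.
- move=> u Du Xu; have [Mu _] := Du.
  rewrite -(canonical_norm_local HY Du); apply: XY; last by rewrite canonical_norm_local.
  by apply: xmeasurable_of_ereal; apply: Mplus_rearrf_half_line; case: Mu.
Qed.

(** The hypothesis only reaches the tail of the rearrangement. The head is bounded by the constant
    [c] of the profile on a set of finite measure, so its [Y]-norm is finite as soon as [c] is. *)
Lemma global_bound X Y : ri_qbf_norm mu X -> ri_qbf_norm mu Y ->
  global_component_stronger mu X Y ->
  exists C : R, (0 < C)%R /\ forall u, global_profile u -> pnorm Y u <= C%:E * pnorm X u.
Proof.
move=> HX HY XY; apply: (inclusion_bound HX HY).
- by move=> u [].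
- move=> u c [Mu [b [b0 ub ueq]]] c0; split.
    by apply: Mplus_scale => //; rewrite lee_fin ltW.
  exists (c%:E * b); split; first by rewrite mule_ge0// lee_fin ltW.
  + by move=> x; rewrite lee_wpmul2l// lee_fin ltW.
  + by move=> x gx; rewrite ueq.
- move=> u_ Du; split.
    split; last first.
      by move=> x; apply: nneseries_ge0 => n _ _; have [[_ ->]] := Du n.
    apply: (ge0_emeasurable_sum (P := xpredT)) => [n x _ _|n _].
      by have [[_ ->]] := Du n.
    by have [[]] := Du n.
  have [c cP] := choice (fun n => (Du n).2).
  exists (\sum_(0 <= n <oo) c n); split.
  + by apply: nneseries_ge0 => n _ _; have [] := cP n.
  + move=> x; apply: lee_nneseries => [n _ _|n _]; first by have [[_ ->]] := Du n.
    by have [_ ->] := cP n.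
  + by move=> x gx; apply: eq_eseriesr => n _; have [_ _ ->] := cP n.
- move=> u [Mu [c [c0 uc ueq]]] Xu; have [mu_ _] := Mu.
  (* [u] equals [c] on a set of measure [1], so an infinite [c] would make its [X]-norm infinite. *)
  have cfin : c < +oo.
    rewrite ltNge leye_eq; apply/negP => /eqP coo; move: Xu; apply/negP.
    rewrite -leNgt -(pnorm_scaleoo HX mlt1) ?mult1//.
    apply: (pnorm_le HX) => // [|x]; first by apply: Mplus_scale => //; exact: Mplus_indic.
    rewrite indicE; have [/set_mem gx|_] := boolP (_ \in _).
      by rewrite mule1 ueq// coo.
    by rewrite mule0; case: Mu.
  have Mr := Mplus_rearrf na sf muT mu_.
  have mI : measurable (`]1%R, +oo[%classic : set R) by exact: measurable_itv.
  pose k x := rearrf mu u (g x) * (\1_(`]1%R, +oo[%classic : set R) (g x))%:E.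
  have Mk : Mplus k.
    split; last by move=> x; rewrite mule_ge0 ?rearrf_ge0.
    apply: emeasurable_funM; first by case: Mr.
    apply: (measurableT_comp (f := fun t : measurableTypeR R =>
      (\1_(`]1%R, +oo[%classic : set R) t)%:E)) => //.
    by case: (@Mplus_indic _ (measurableTypeR R) R _ mI).
  have rc (t : R) : (0 <= t)%R -> rearrf mu u t <= c.
    case: c c0 uc {ueq} cfin => [c| |]// c0 uc _ t0.
    rewrite leNgt lt_rearrf// -leNgt (_ : [set x | _] = set0) ?measure0 ?lee_fin//.
    by apply/seteqP; split => // x /=; rewrite ltNge uc.
  have Yk : pnorm Y k < +oo.
    rewrite -(canonical_norm_rearr_on HY Mu mI); apply: XY.
    + exact/xmeasurable_of_ereal/Mplus_rearrf_half_line.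
    + by rewrite rearr_rearrf// (le_lt_trans (rc 1%R _)).
    + rewrite (canonical_norm_rearr_on HX Mu mI); apply: le_lt_trans Xu.
      rewrite -(pnorm_rearrf na sf muT HX Mu); apply: (pnorm_le HX) => // x.
      rewrite -[leRHS]mule1 lee_wpmul2l ?rearrf_ge0//.
      by rewrite lee_fin indicE; case: (_ \in _).
  have [K [K1 YK]] := pnorm_triangle HY.
  (* The head includes the level [g x = 1], since the tail interval is open there. *)
  pose le1 := ~` (g @^-1` (`]1%R, +oo[%classic : set R)).
  have mle1 : measurable le1.
    apply: measurableC; rewrite -[X in measurable X]setTI.
    exact: mg.
  have le1_fin : mu le1 < +oo.
    apply: (@le_lt_trans _ _ (mu (setT `&` [set x | ((g x : R) < 2)%R]))); last first.
      by rewrite (sigma_map_lt na sf muT)// ltry.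
    apply: le_measure; rewrite ?inE//.
      apply: measurableI => //; rewrite -preimage_itvNyo -[X in measurable X]setTI.
      by apply: mg => //; exact: measurable_itv.
    move=> x; rewrite /le1 /= in_itv /= andbT => /negP; rewrite -leNgt => x1.
    by split => //; apply: le_lt_trans x1 _; rewrite ltr1n.
  have Mc : Mplus (fun x => c * (\1_le1 x)%:E).
    by apply: Mplus_scale => //; exact: Mplus_indic.
  rewrite -(pnorm_rearrf na sf muT HY Mu).
  apply: (@le_lt_trans _ _ (pnorm Y (fun x => c * (\1_le1 x)%:E + k x))).
    apply: (pnorm_le HY) => // [|x]; first exact: Mplus_add.
    rewrite /k !indicE in_setC.
    have -> : (x \in g @^-1` (`]1%R, +oo[%classic : set R)) =
       ((g x : R) \in (`]1%R, +oo[%classic : set R)) by apply/idP/idP; rewrite !inE.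
    case: (_ \in _) => /=; first by rewrite mule0 add0e mule1.
    by rewrite mule0 adde0 mule1 rc.
  apply: le_lt_trans (YK _ _ Mc Mk) _.
  have : pnorm Y (fun x => c * (\1_le1 x)%:E) < +oo.
    have cfin' : c \is a fin_num by rewrite ge0_fin_numE.
    rewrite -(fineK cfin') (pnorm_scale HY) ?fine_ge0//; last exact: Mplus_indic.
    by rewrite lte_mul_pinfty ?lee_fin ?fine_ge0// (pnorm_indic_fin HY mle1 le1_fin).
  move=> Yc; rewrite lte_mul_pinfty ?lee_fin ?(le_trans ler01)//.
  by rewrite lte_add_pinfty.
Qed.

End Components.

(** * Calculus of rearrangements *)

Section RearrangementCalculus.
Context d (T : measurableType d) (R : realType) (mu : {measure set T -> \bar R}).
Implicit Types (u v : T -> \bar R).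

Lemma mu_lt_rearrf u (t : R) (b : R) : measurable_fun setT u -> (0 <= b)%R ->
  rearrf mu u t <= b%:E -> mu [set x | b%:E < u x] <= t%:E.
Proof. by move=> mu_ b0; rewrite leNgt lt_rearrf// -leNgt. Qed.

(** If [a] and [b] are the two values on the right, [u + v > a + b] forces [u > a] or [v > b], and
    each of these sets has measure at most [t / 2]. *)
Lemma rearrfD u v (t : R) : Mplus u -> Mplus v ->
  rearrf mu (fun x => u x + v x) t <= rearrf mu u (t / 2) + rearrf mu v (t / 2).
Proof.
move=> Mu Mv; have [mu_ _] := Mu; have [mv _] := Mv.
have := rearrf_ge0 mu u (t / 2); have := rearrf_ge0 mu v (t / 2).
case Ea : (rearrf mu u _) => [a| |]//; case Eb : (rearrf mu v _) => [b| |]//;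
  rewrite ?addey ?addye ?leey// !lee_fin => b0 a0.
have [muv _] := Mplus_add Mu Mv.
rewrite leNgt lt_rearrf ?addr_ge0// -leNgt.
have ua : mu [set x | a%:E < u x] <= (t / 2)%:E by apply: mu_lt_rearrf; rewrite ?Ea.
have vb : mu [set x | b%:E < v x] <= (t / 2)%:E by apply: mu_lt_rearrf; rewrite ?Eb.
have mA := measurable_lt_fun a%:E mu_; have mB := measurable_lt_fun b%:E mv.
rewrite (splitr t) EFinD (le_trans _ (leeD ua vb))//.
apply: le_trans (measureU2 _ mA mB); apply: le_measure; rewrite ?inE.
- exact: measurable_lt_fun.
- exact: measurableU.
move=> x /=; apply: contraPP => /not_orP[/negP + /negP]; rewrite -!leNgt => ux vx.
by apply/negP; rewrite -leNgt leeD.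
Qed.

Lemma rearrfZ (c : R) u (t : R) : (0 <= c)%R -> (0 <= t)%R -> Mplus u ->
  rearrf mu (fun x => c%:E * u x) t = c%:E * rearrf mu u t.
Proof.
move=> c0 t0 Mu; have [mu_ u0] := Mu.
apply: eq_ge0_lt => [||s s0]; first exact: rearrf_ge0.
  by rewrite mule_ge0 ?lee_fin ?rearrf_ge0.
have Mc : Mplus (fun x => c%:E * u x) by exact: Mplus_scale.
have [mc _] := Mc; rewrite lt_rearrf//.
have [->|cn0] := eqVneq c 0%R.
  rewrite mul0e (_ : [set x | _] = set0).
    by rewrite measure0 !lte_fin ltNge t0 ltNge s0.
  by apply/seteqP; split => // x /=; rewrite mul0e lte_fin ltNge s0.
have cp : (0 < c)%R by rewrite lt_neqAle eq_sym cn0.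
rewrite (_ : [set x | _] = [set x | (c^-1 * s)%:E < u x]); last first.
  by apply/seteqP; split => x /=; rewrite EFinM lte_pdivrMl.
by rewrite -lt_rearrf ?mulr_ge0 ?invr_ge0// EFinM lte_pdivrMl.
Qed.

(** If the supremum of the rearrangements at [t] is a real [l], the sets where [u_ n > l] have
    measure at most [t] and increase, up to null sets, to a set containing almost all of the set
    where [u > l]. Hence the rearrangement of [u] at [t] is at most [l]. *)
Lemma rearrf_cvg (u_ : nat -> T -> \bar R) u (t : R) :
  (forall n, Mplus (u_ n)) -> Mplus u ->
  {ae mu, forall x, (forall n, u_ n x <= u_ n.+1 x) /\ u_ ^~ x @ \oo --> u x} ->
  (forall n, rearrf mu (u_ n) t <= rearrf mu (u_ n.+1) t) /\
  (fun n => rearrf mu (u_ n) t) @ \oo --> rearrf mu u t.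
Proof.
move=> Mu_ Mu uu; have mu_ n : measurable_fun setT (u_ n) by have [] := Mu_ n.
have [mu0 _] := Mu.
have ndr n : rearrf mu (u_ n) t <= rearrf mu (u_ n.+1) t.
  by apply: rearrf_le => //; apply: filterS uu => x [].
split => //.
have mono x : (forall n, u_ n x <= u_ n.+1 x) -> {homo u_ ^~ x : i j / (i <= j)%N >-> i <= j}.
  by move=> ux; apply: homo_leq => //; exact: le_trans.
have cvg := ereal_nondecreasing_cvgn (homo_leq (@lexx _ _) (fun _ _ _ => @le_trans _ _ _ _ _) ndr).
suff -> : rearrf mu u t = ereal_sup (range (fun n => rearrf mu (u_ n) t)) by exact: cvg.
apply/eqP; rewrite eq_le; apply/andP; split; last first.
  apply: ge_ereal_sup => _ [n _ <-]; apply: rearrf_le => //.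
  apply: filterS uu => x [ux /cvg_lim <-]//; apply: lime_ge.
    by apply: ereal_nondecreasing_is_cvgn; exact: mono.
  by exists n => // m /= nm; exact: mono.
set L := ereal_sup _.
have uL n : rearrf mu (u_ n) t <= L by apply: ereal_sup_ubound; exists n.
have := le_trans (rearrf_ge0 _ _ _) (uL 0%N).
case EL : L => [l| |] // l0; last by rewrite leey.
rewrite EL in uL; rewrite lee_fin in l0.
rewrite leNgt lt_rearrf// -leNgt.
pose F n := [set x | l%:E < u_ n x].
have mF n : measurable (F n) by exact: measurable_lt_fun.
(* Monotonicity holds only almost everywhere; the finite unions increase everywhere and exceed [F n]
   only by a null set. *)
pose G n := \big[setU/set0]_(i < n.+1) F i.
have mG n : measurable (G n) by exact: bigsetU_measurable.
have GP n x : G n x <-> exists2 i, (i <= n)%N & F i x.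
  rewrite /G -(bigcup_mkord n.+1 F); split; first by move=> [i ? ?]; exists i.
  by move=> [i ? ?]; exists i.
have muG n : mu (G n) <= t%:E.
  apply: le_trans (mu_lt_rearrf (mu_ n) l0 (uL n)).
  apply: (le_measure_ae (mG n) (mF n)); apply: filterS uu => x [ux _] /GP[i ni].
  by rewrite /F /= => /lt_le_trans; apply; exact: mono.
have mGU : measurable (\bigcup_n G n) by exact: bigcupT_measurable.
have Gcvg : mu \o G @ \oo --> mu (\bigcup_n G n).
  apply: nondecreasing_cvg_mu => // n m nm; apply/subsetPset => x /GP[i ni Fi].
  by apply/GP; exists i => //; exact: leq_trans nm.
apply: (@le_trans _ _ (mu (\bigcup_n G n))).
  apply: (le_measure_ae (measurable_lt_fun l%:E mu0) mGU).
  apply: filterS uu => x [ux ucvg] /= lu; apply: contrapT => nG.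
  move: lu; apply/negP; rewrite -leNgt -(cvg_lim _ ucvg)//.
  apply: lime_le; first by apply/cvg_ex; eexists; exact: ucvg.
  near=> n; rewrite leNgt; apply/negP => lun; apply: nG.
  by exists n => //; apply/GP; exists n.
rewrite -(cvg_lim _ Gcvg)//; apply: lime_le; first by apply/cvg_ex; eexists; exact: Gcvg.
by near=> n; exact: muG.
Unshelve. all: by end_near.
Qed.

End RearrangementCalculus.

(** * The amalgam quasinorm *)

Section XcomplexArithmetic.
Context (R : realType).

Lemma xmodD (z w : xcomplex R) : xmod (xadd z w) <= xmod z + xmod w.
Proof.
case: z w => [z|] [w|] //=.
by rewrite -EFinD lee_fin le_normcD.
Qed.

Lemma xmod_scale (a : R[i]) (r : \bar R) : 0 <= r ->
  xmod (xscale a (of_ereal r)) = (ComplexField.Normc.normc a)%:E * r.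
Proof.
have n0 : (0 <= ComplexField.Normc.normc a)%R by case: a => ? ?; exact: sqrtr_ge0.
case: r => [r| |]//= r0.
  by rewrite ComplexField.Normc.normcM /= expr0n /= addr0 sqrtr_sqr ger0_norm.
case: ifPn => [/eqP ->|an0].
  by rewrite ComplexField.Normc.normc0 mul0e /= expr0n /= addr0 sqrtr0.
rewrite gt0_muley// lte_fin lt_neqAle n0 andbT eq_sym.
by apply: contra_neq an0; exact: ComplexField.Normc.eq0_normc.
Qed.

End XcomplexArithmetic.

Section Amalgam.
Context d (T : measurableType d) (R : realType) (mu : {measure set T -> \bar R}).
Context (na : nonatomic mu) (sf : sigma_finite setT mu) (muT : mu setT = +oo).
Context (A B : (T -> xcomplex R) -> \bar R) (HA : ri_qbf_norm mu A) (HB : ri_qbf_norm mu B).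
Implicit Types (u v : T -> \bar R).

Let g : T -> R := sigma_map mu.
Let g0 x : (0 <= g x)%R. Proof. exact: sigma_map_ge0 na sf muT x. Qed.

Definition local_part u (t : R) := if (t < 1)%R then rearrf mu u t else 0.

(* Flattening [f^*] on [0, 1[ to the value [f^*(1)], rather than cutting it off,
   keeps the profile non-increasing and costs only a multiple of the local part. *)
Definition global_part u (t : R) := rearrf mu u (Num.max t 1%R).

Definition amalgam u := pnorm B (fun x => local_part u (g x)) +
  pnorm A (fun x => global_part u (g x)).

Lemma local_part_ge0 u t : 0 <= local_part u t.
Proof. by rewrite /local_part; case: ifP => // _; exact: rearrf_ge0. Qed.

Lemma global_part_ge0 u t : 0 <= global_part u t.
Proof. exact: rearrf_ge0. Qed.

Lemma distr_local_part u : Mplus u ->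
  distr (local_part u) (fun s => mine (mu [set x | s%:E < u x]) 1).
Proof. by move=> [mu_ _]; exact: (distr_cut ler01 (distr_rearrf mu mu_)). Qed.

Lemma distr_global_part u : Mplus u -> distr (global_part u)
  (fun s => if 1 < mu [set x | s%:E < u x] then mu [set x | s%:E < u x] else 0).
Proof. by move=> [mu_ _]; exact: (distr_flat ler01 (distr_rearrf mu mu_)). Qed.

Lemma Mplus_local_part u : Mplus u -> Mplus (fun x => local_part u (g x)).
Proof. by move=> Mu; exact: (Mplus_comp na sf muT (distr_local_part Mu) (local_part_ge0 u)). Qed.

Lemma Mplus_global_part u : Mplus u -> Mplus (fun x => global_part u (g x)).
Proof. by move=> Mu; exact: (Mplus_comp na sf muT (distr_global_part Mu) (global_part_ge0 u)). Qed.

Lemma local_profile_part u : Mplus u -> local_profile mu (fun x => local_part u (g x)).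
Proof.
move=> Mu; split; first exact: Mplus_local_part.
by move=> x gx; rewrite /local_part ltNge gx.
Qed.

Lemma global_profile_part u : Mplus u -> global_profile mu (fun x => global_part u (g x)).
Proof.
move=> Mu; split; first exact: Mplus_global_part.
exists (rearrf mu u 1); split; first exact: rearrf_ge0.
- by move=> x; apply: rearrf_antitone; rewrite le_max lexx orbT.
- by move=> x gx; rewrite /global_part max_r// ltW.
Qed.

Lemma pnorm_local_part_le X u : ri_qbf_norm mu X -> Mplus u ->
  pnorm X (fun x => local_part u (g x)) <= pnorm X u.
Proof.
move=> HX Mu; apply: (pnorm_dom na sf muT HX) => //; first exact: Mplus_local_part.
move=> s s0; rewrite (mu_comp na sf muT (distr_local_part Mu))//.
by rewrite ge_min lexx.
Qed.

Lemma pnorm_global_part_le X u : ri_qbf_norm mu X -> Mplus u ->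
  pnorm X (fun x => global_part u (g x)) <= pnorm X u.
Proof.
move=> HX Mu; apply: (pnorm_dom na sf muT HX) => //; first exact: Mplus_global_part.
move=> s s0; rewrite (mu_comp na sf muT (distr_global_part Mu))//.
by case: ifP.
Qed.

Lemma amalgam_ge0 u : Mplus u -> 0 <= amalgam u.
Proof.
move=> Mu; apply: adde_ge0.
  by apply: (pnorm_ge0 HB); exact: Mplus_local_part.
by apply: (pnorm_ge0 HA); exact: Mplus_global_part.
Qed.

Lemma amalgam_le u v : Mplus u -> Mplus v -> {ae mu, forall x, u x <= v x} ->
  amalgam u <= amalgam v.
Proof.
move=> Mu Mv uv; have r t : rearrf mu u t <= rearrf mu v t.
  by apply: rearrf_le => //; [case: Mu|case: Mv].
apply: leeD.
  apply: (pnorm_le HB); try exact: Mplus_local_part.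
  by move=> x; rewrite /local_part; case: ifP.
apply: (pnorm_le HA) => [||x]; try exact: Mplus_global_part.
exact: r.
Qed.

Lemma amalgamZ (c : R) u : (0 <= c)%R -> Mplus u ->
  amalgam (fun x => c%:E * u x) = c%:E * amalgam u.
Proof.
move=> c0 Mu; rewrite /amalgam ge0_muleDr; last 2 first.
- by apply: (pnorm_ge0 HB); exact: Mplus_local_part.
- by apply: (pnorm_ge0 HA); exact: Mplus_global_part.
rewrite -(pnorm_scale HB)//; last exact: Mplus_local_part.
rewrite -(pnorm_scale HA)//; last exact: Mplus_global_part.
congr (_ + _); congr pnorm; apply/funext => x.
  by rewrite /local_part; case: ifP => _; rewrite ?mule0// rearrfZ.
by rewrite /global_part rearrfZ// le_max g0.
Qed.

Lemma amalgam_eq0 u : Mplus u -> amalgam u = 0 <-> {ae mu, forall x, u x = 0}.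
Proof.
move=> Mu; have [mu_ u0] := Mu; split; last first.
  have M0 : Mplus (fun=> 0 : \bar R) by split => //; exact: (@measurable_cst _ _ T).
  move=> uae; apply/eqP; rewrite eq_le amalgam_ge0// andbT.
  apply: (@le_trans _ _ (amalgam (fun=> 0))).
    apply: amalgam_le => //; by apply: filterS uae => x ux; rewrite ux.
  rewrite (_ : amalgam _ = amalgam (fun x => 0%:E * (fun=> 0) x)); last first.
    by congr amalgam; apply/funext => x; rewrite mul0e.
  by rewrite amalgamZ// mul0e.
move/eqP; rewrite padde_eq0; last 2 first.
- by apply: (pnorm_ge0 HB); exact: Mplus_local_part.
- by apply: (pnorm_ge0 HA); exact: Mplus_global_part.
move=> /andP[/eqP /(qbfn_eq0 HB (Mplus_local_part Mu)) l0 _].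
(* The local part alone decides: its support has measure [min(mu {u > 0}, 1)], which vanishes only
   if [u] is null. *)
have : mine (mu [set x | 0%:E < u x]) 1 <= 0.
  rewrite -(mu_comp na sf muT (distr_local_part Mu))// -(measure0 mu).
  apply: le_measure_ae => //.
    by apply: measurable_lt_fun; case: (Mplus_local_part Mu).
  by apply: filterS l0 => x /= ->; rewrite ltxx.
rewrite ge_min [1 <= 0]leNgt lte01 orbF => u00.
exists [set x | 0 < u x]; split; first exact: measurable_lt_fun.
  by apply/eqP; rewrite eq_le u00 measure_ge0.
by move=> x /= /eqP; rewrite lt0e => ->; exact: u0.
Qed.

Lemma sigma_map_sublevel (b : R) : (0 < b)%R ->
  [/\ measurable [set x | (g x < b)%R], mu [set x | (g x < b)%R] < +oo &
      0 < mu [set x | (g x < b)%R]].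
Proof.
move=> b0; have -> : mu [set x | (g x < b)%R] = b%:E.
  by have := sigma_map_lt na sf muT (ltW b0); rewrite setTI.
split; rewrite ?ltry ?lte_fin//.
have := measurable_lt_half_line (sigma_map_measurable na sf muT) b%:E.
by congr measurable; apply/seteqP; split => x /=; rewrite lte_fin.
Qed.

(** The local part is stable under halving, because [t / 2 < 1] when [t < 1]. The global part is
    not: it reads the rearrangements at [max t 1 / 2], hence also on [[1/2, 1[], where the amalgam
    is measured in [B]. The overshoot is at most [u^*(1/2)] on [sigma < 1], and its [A]-norm is
    controlled by the [B]-norm of the same constant on [sigma < 1/2], where the local part dominates
    it. *)
Lemma amalgam_triangle : exists K : R, (1 <= K)%R /\
  forall u v, Mplus u -> Mplus v ->
    amalgam (fun x => u x + v x) <= K%:E * (amalgam u + amalgam v).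
Proof.
have [KB [KB1 BT]] := pnorm_triangle HB.
have [KA [KA1 AT]] := pnorm_triangle HA.
have [DB [DB0 BD]] := dilation_bound na sf muT HB.
have [DA [DA0 AD]] := dilation_bound na sf muT HA.
have [mh hoo h0] := sigma_map_sublevel (ltr01 : 0 < 1 :> R)%R.
have half0 : (0 < 2^-1 :> R)%R by rewrite invr_gt0.
have [mk koo k0] := sigma_map_sublevel half0.
have [C [C0 AB]] := pnorm_indic_compare HA HB mh hoo mk k0 koo.
have EK0 (r : R) : (1 <= r)%R -> 0 <= r%:E.
  by move=> r1; rewrite lee_fin (le_trans ler01).
have B0 u : Mplus u -> 0 <= pnorm B (fun x => local_part u (g x)).
  by move=> Mu; apply: (pnorm_ge0 HB); exact: Mplus_local_part.
have A0 u : Mplus u -> 0 <= pnorm A (fun x => global_part u (g x)).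
  by move=> Mu; apply: (pnorm_ge0 HA); exact: Mplus_global_part.
have localD u v : Mplus u -> Mplus v ->
    pnorm B (fun x => local_part (fun y => u y + v y) (g x)) <=
    (KB * DB)%:E * (amalgam u + amalgam v).
  move=> Mu Mv.
  have M2 w : Mplus w -> Mplus (fun x => local_part w (g x / 2)%R).
    move=> Mw; apply: (Mplus_comp na sf muT (distr_half (distr_local_part Mw))).
    by move=> t; exact: local_part_ge0.
  have bnd w : Mplus w -> pnorm B (fun x => local_part w (g x / 2)%R) <= DB%:E * amalgam w.
    move=> Mw; apply: le_trans (BD _ _ (distr_local_part Mw) (local_part_ge0 w)) _.
    by rewrite lee_wpmul2l ?lee_fin ?(ltW DB0)// leeDl// A0.
  apply: (@le_trans _ _ (pnorm B
      (fun x => local_part u (g x / 2)%R + local_part v (g x / 2)%R))).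
    apply: (pnorm_le HB) => [||x].
    - exact/Mplus_local_part/Mplus_add.
    - by apply: Mplus_add; exact: M2.
    rewrite {1}/local_part; case: ifPn => gx; last by rewrite adde_ge0 ?local_part_ge0.
    have gx2 : (g x / 2 < 1)%R by have := g0 x; lra.
    by rewrite /local_part gx2 rearrfD.
  apply: le_trans (BT _ _ (M2 _ Mu) (M2 _ Mv)) _.
  rewrite EFinM -muleA lee_wpmul2l ?EK0//.
  by rewrite ge0_muleDr ?amalgam_ge0// leeD ?bnd.
(* Flattening at [1/2] commutes with halving in the required way:
   [max (t / 2) (1/2) = max t 1 / 2]. *)
pose k u t := rearrf mu u (Num.max t 2^-1)%R.
have k0' u t : 0 <= k u t by exact: rearrf_ge0.
have dk u (Mu : Mplus u) := distr_flat (ltW half0) (distr_rearrf mu (proj1 Mu)).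
have Mk u : Mplus u -> Mplus (fun x => k u (g x)).
  by move=> Mu; exact: (Mplus_comp na sf muT (dk u Mu) (k0' u)).
have kbnd u : Mplus u -> pnorm A (fun x => k u (g x)) <= (KA * (C + 1))%:E * amalgam u.
  move=> Mu; set c := rearrf mu u 2^-1%R.
  have c0 : 0 <= c by exact: rearrf_ge0.
  have Mc (E : set T) : measurable E -> Mplus (fun x => c * (\1_E x)%:E).
    by move=> mE; apply: Mplus_scale => //; exact: Mplus_indic.
  apply: (@le_trans _ _ (pnorm A
      (fun x => c * (\1_[set x | (g x < 1)%R] x)%:E + global_part u (g x)))).
    apply: (pnorm_le HA) => [||x]; first exact: Mk.
      by apply: Mplus_add; [exact: Mc|exact: Mplus_global_part].
    rewrite indicE; have [/set_mem /= gx|gx] := boolP (_ \in _).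
      rewrite mule1 -[leLHS]adde0 leeD ?global_part_ge0//.
      by apply: rearrf_antitone; rewrite le_max lexx orbT.
    rewrite mule0 add0e /k /global_part.
    have g1 : (1 <= g x)%R by rewrite leNgt; apply: contra gx => gx; rewrite inE.
    by rewrite !max_l//; lra.
  apply: le_trans (AT _ _ (Mc _ mh) (Mplus_global_part Mu)) _.
  rewrite EFinM -muleA lee_wpmul2l ?EK0//.
  rewrite EFinD ge0_muleDl ?lee_fin ?(ltW C0)// mul1e leeD//; last by rewrite leeDr// B0.
  apply: le_trans (AB c c0) _; rewrite lee_wpmul2l ?lee_fin ?(ltW C0)//.
  apply: le_trans (_ : pnorm B (fun x => local_part u (g x)) <= _); last by rewrite leeDl// A0.
  apply: (pnorm_le HB) => [||x]; [exact: Mc|exact: Mplus_local_part|].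
  rewrite indicE; have [/set_mem /= gx|gx] := boolP (_ \in _); last first.
    by rewrite mule0 local_part_ge0.
  rewrite mule1 /local_part ifT; last by lra.
  by apply: rearrf_antitone; rewrite ltW.
have globalD u v : Mplus u -> Mplus v ->
    pnorm A (fun x => global_part (fun y => u y + v y) (g x)) <=
    (KA * (DA * (KA * (C + 1))))%:E * (amalgam u + amalgam v).
  move=> Mu Mv.
  have M2 w : Mplus w -> Mplus (fun x => k w (g x / 2)%R).
    move=> Mw; apply: (Mplus_comp na sf muT (distr_half (dk w Mw))).
    by move=> t; exact: k0'.
  have bnd w : Mplus w -> pnorm A (fun x => k w (g x / 2)%R) <=
      (DA * (KA * (C + 1)))%:E * amalgam w.
    move=> Mw; apply: le_trans (AD _ _ (dk w Mw) (k0' w)) _.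
    by rewrite EFinM -muleA lee_wpmul2l ?lee_fin ?(ltW DA0)// kbnd.
  apply: (@le_trans _ _ (pnorm A (fun x => k u (g x / 2)%R + k v (g x / 2)%R))).
    apply: (pnorm_le HA) => [||x].
    - exact/Mplus_global_part/Mplus_add.
    - by apply: Mplus_add; exact: M2.
    rewrite /global_part /k.
    have -> : (Num.max (g x / 2) 2^-1 = Num.max (g x) 1 / 2)%R.
      by rewrite maxr_pMl ?invr_ge0// mul1r.
    exact: rearrfD.
  apply: le_trans (AT _ _ (M2 _ Mu) (M2 _ Mv)) _.
  rewrite EFinM -muleA lee_wpmul2l ?EK0//.
  by rewrite ge0_muleDr ?amalgam_ge0// leeD ?bnd.
have P1 : (0 <= KB * DB)%R by rewrite mulr_ge0 ?(le_trans ler01 KB1)// ltW.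
have KA0 := le_trans ler01 KA1.
have P2 : (0 <= KA * (DA * (KA * (C + 1))))%R.
  by rewrite !mulr_ge0 ?(ltW DA0)// addr_ge0// ltW.
(* The sum of the local and global constants; the extra [1] secures [1 <= K]. *)
exists (1 + (KB * DB + KA * (DA * (KA * (C + 1)))))%R; split.
  by rewrite lerDl addr_ge0.
move=> u v Mu Mv; have N0 : 0 <= amalgam u + amalgam v by rewrite adde_ge0 ?amalgam_ge0.
apply: le_trans (leeD (localD u v Mu Mv) (globalD u v Mu Mv)) _.
rewrite -ge0_muleDl ?lee_fin// -EFinD lee_wpmul2r// lee_fin.
by rewrite lerDr.
Qed.

Lemma amalgam_fatou (u_ : nat -> T -> \bar R) u :
  (forall n, Mplus (u_ n)) -> Mplus u ->
  {ae mu, forall x, (forall n, u_ n x <= u_ n.+1 x) /\ u_ ^~ x @ \oo --> u x} ->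
  (forall n, amalgam (u_ n) <= amalgam (u_ n.+1)) /\
  (fun n => amalgam (u_ n)) @ \oo --> amalgam u.
Proof.
move=> Mu_ Mu uu.
have rcvg (t : R) := rearrf_cvg t Mu_ Mu uu.
have Bae : {ae mu, forall x,
    (forall n, local_part (u_ n) (g x) <= local_part (u_ n.+1) (g x)) /\
    (fun n => local_part (u_ n) (g x)) @ \oo --> local_part u (g x)}.
  apply: aeW => x; rewrite /local_part; case: ifP => _; first exact: rcvg.
  by split => //; exact: cvg_cst.
have Aae : {ae mu, forall x,
    (forall n, global_part (u_ n) (g x) <= global_part (u_ n.+1) (g x)) /\
    (fun n => global_part (u_ n) (g x)) @ \oo --> global_part u (g x)}.
  by apply: aeW => x; exact: rcvg.
have [Bmono Bcvg] := qbfn_fatou HB (fun n => Mplus_local_part (Mu_ n))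
  (Mplus_local_part Mu) Bae.
have [Amono Acvg] := qbfn_fatou HA (fun n => Mplus_global_part (Mu_ n))
  (Mplus_global_part Mu) Aae.
split; first by move=> n; apply: leeD; [exact: Bmono|exact: Amono].
apply: (cvgeD _ Bcvg Acvg); apply: ge0_adde_def; rewrite inE.
  by apply: (pnorm_ge0 HB); exact: Mplus_local_part.
by apply: (pnorm_ge0 HA); exact: Mplus_global_part.
Qed.

Definition amalgam_norm (f : T -> xcomplex R) := amalgam (fun x => xmod (f x)).

Lemma amalgam_norm_of_ereal u : Mplus u -> amalgam_norm (of_ereal \o u) = amalgam u.
Proof.
move=> [_ u0]; congr amalgam; apply/funext => x /=.
by rewrite xmod_of_ereal.
Qed.

Lemma ri_amalgam_norm : ri_qbf_norm mu amalgam_norm.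
Proof.
split.
- by move=> f mf; apply: amalgam_ge0; exact: Mplus_xmod.
- move=> f mf; congr amalgam; apply/funext => x.
  by rewrite xmod_of_ereal ?xmod_ge0.
- move=> a u Mu; rewrite amalgam_norm_of_ereal// -amalgamZ//; last first.
    by case: a => ? ?; exact: sqrtr_ge0.
  congr amalgam; apply/funext => x.
  by rewrite xmod_scale//; case: Mu.
- by move=> u Mu; rewrite amalgam_norm_of_ereal//; exact: amalgam_eq0.
- have [K [K1 KP]] := amalgam_triangle; exists K; split => // u v Mu Mv.
  rewrite (amalgam_norm_of_ereal Mu) (amalgam_norm_of_ereal Mv).
  by have := KP _ _ Mu Mv; rewrite -(amalgam_norm_of_ereal (Mplus_add Mu Mv)).
- by move=> u v Mu Mv uv; rewrite !amalgam_norm_of_ereal//; exact: amalgam_le.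
- move=> u_ u Mu_ Mu uu.
  have -> : (fun n => amalgam_norm (of_ereal \o u_ n)) = (fun n => amalgam (u_ n)).
    by apply/funext => n; rewrite amalgam_norm_of_ereal.
  have [h1 h2] := amalgam_fatou Mu_ Mu uu.
  rewrite amalgam_norm_of_ereal//; split => // n.
  by rewrite !amalgam_norm_of_ereal.
- move=> E mE Eoo; have ME := Mplus_indic R mE.
  have -> : amalgam_norm (fun x => of_ereal (\1_E x)%:E) = _ := amalgam_norm_of_ereal ME.
  apply: (@le_lt_trans _ _ (pnorm B (fun x => (\1_E x)%:E) + pnorm A (fun x => (\1_E x)%:E))).
    by apply: leeD; [exact: pnorm_local_part_le|exact: pnorm_global_part_le].
  apply: lte_add_pinfty; first exact: (pnorm_indic_fin HB mE Eoo).
  exact: (pnorm_indic_fin HA mE Eoo).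
- move=> f1 f2 mf1 mf2 fE; rewrite /amalgam_norm /amalgam.
  have rE x : rearrf mu (fun x => xmod (f1 x)) (g x) = rearrf mu (fun x => xmod (f2 x)) (g x).
    exact: fE.
  congr (_ + _); congr pnorm; apply/funext => x.
    by rewrite /local_part rE.
  by apply: fE; rewrite le_max g0.
Qed.

(** With [c = f^*(1)], the piece of [f] where its modulus exceeds [c] lives on a set of measure at
    most [1], so its distribution is below that of the local part. The other piece is bounded by
    [c], and for [s < c] the set where the modulus of [f] exceeds [s] has measure above [1], where
    flattening leaves the distribution function unchanged. *)
Lemma sum_norm_le_amalgam (f : T -> xcomplex R) : xmeasurable f ->
  sum_norm mu A B f <= amalgam_norm f.
Proof.
move=> mf; have Mf := Mplus_xmod mf; have [mf_ f0] := Mf.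
have [/eqP ->|Nfin] := boolP (amalgam_norm f == +oo); first exact: leey.
set u := fun x => xmod (f x) in Mf mf_ f0.
have B0 : 0 <= pnorm B (fun x => local_part u (g x)).
  by apply: (pnorm_ge0 HB); exact: Mplus_local_part.
have A0 : 0 <= pnorm A (fun x => global_part u (g x)).
  by apply: (pnorm_ge0 HA); exact: Mplus_global_part.
have : amalgam_norm f < +oo by rewrite ltey.
rewrite /amalgam_norm /amalgam -/u => Noo.
have Bfin : pnorm B (fun x => local_part u (g x)) < +oo.
  by apply: le_lt_trans Noo; rewrite leeDl.
have Afin : pnorm A (fun x => global_part u (g x)) < +oo.
  by apply: le_lt_trans Noo; rewrite leeDr.
have [mh hoo h0] := sigma_map_sublevel (ltr01 : (0 < 1 :> R)%R).
(* On [[0, 1[] the local part is at least [u^*(1)], so an infinite value there would contradict the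
   finite [B]-norm. *)
have [c [c0 rc]] : exists c : R, (0 <= c)%R /\ rearrf mu u 1 = c%:E.
  have := rearrf_ge0 mu u 1; case E : (rearrf mu u 1) => [c| |]// c0; first by exists c.
  exfalso; move: Bfin; apply/negP; rewrite -leNgt -(pnorm_scaleoo HB mh h0).
  apply: (pnorm_le HB) => [||x].
  - by apply: Mplus_scale => //; exact: Mplus_indic.
  - exact: Mplus_local_part.
  rewrite indicE; have [/set_mem /= gx|_] := boolP (_ \in _); last first.
    by rewrite mule0 local_part_ge0.
  by rewrite mule1 /local_part gx -E rearrf_antitone// ltW.
pose H := [set x | c%:E < u x].
have mH : measurable H by exact: measurable_lt_fun.
have muH : mu H <= 1 by apply: (@mu_lt_rearrf _ _ _ mu u 1%R c) => //; rewrite rc.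
(* Restricting [f], rather than subtracting the level [c], keeps phases and infinite values intact:
   at each point one summand is zero. *)
pose fB x := if x \in H then f x else XFin 0%R.
pose fA x := if x \in H then XFin 0%R else f x.
have xm_if (E : set T) (h : T -> xcomplex R) : measurable E ->
    h = (fun x => if x \in E then f x else XFin 0%R) -> xmeasurable h.
  move=> mE ->; have [mI mRe mIm] := mf.
  have mb : measurable_fun setT (fun x => x \in E).
    apply: (measurable_fun_bool true); rewrite setTI (_ : _ @^-1` _ = E)//.
    by apply/seteqP; split => x /=; [exact: set_mem|exact: mem_set].
  split.
  - rewrite (_ : [set x | _] = E `&` [set x | f x = XInf]); first exact: measurableI.
    apply/seteqP; split => x /=; first by case: ifPn => // /set_mem.
    by move=> [Ex]; rewrite mem_set.
  - rewrite (_ : (fun x => _) = fun x => if x \in E then xRe (f x) else 0%R).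
      by apply: measurable_fun_if => //; apply: measurable_funTS.
    by apply/funext => x; case: ifP.
  - rewrite (_ : (fun x => _) = fun x => if x \in E then xIm (f x) else 0%R).
      by apply: measurable_fun_if => //; apply: measurable_funTS.
    by apply/funext => x; case: ifP.
have mfB : xmeasurable fB by exact: (xm_if H).
have mfA : xmeasurable fA.
  apply: (xm_if (~` H)); first exact: measurableC.
  by apply/funext => x; rewrite /fA in_setC; case: ifP.
have MfB := Mplus_xmod mfB; have MfA := Mplus_xmod mfA.
have Ble : B fB <= pnorm B (fun x => local_part u (g x)).
  rewrite -(pnorm_xmod HB mfB); apply: (pnorm_dom na sf muT HB) => //.
    exact: Mplus_local_part.
  move=> s s0; rewrite (mu_comp na sf muT (distr_local_part Mf))// le_min.
  have mlt := measurable_lt_fun s%:E (proj1 MfB).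
  have mltu := measurable_lt_fun s%:E mf_.
  have fB0 : xmod (XFin 0%R : xcomplex R) = 0 by rewrite /= expr0n /= addr0 sqrtr0.
  apply/andP; split; last apply: (le_trans _ muH); apply: le_measure; rewrite ?inE//.
    by move=> x /=; rewrite /fB; case: ifP => // _; rewrite fB0 lte_fin ltNge s0.
  move=> x /=; rewrite /fB; case: ifPn => [/set_mem//|_].
  by rewrite fB0 lte_fin ltNge s0.
have Ale : A fA <= pnorm A (fun x => global_part u (g x)).
  rewrite -(pnorm_xmod HA mfA); apply: (pnorm_dom na sf muT HA) => //.
    exact: Mplus_global_part.
  move=> s s0; rewrite (mu_comp na sf muT (distr_global_part Mf))//.
  have fA0 : xmod (XFin 0%R : xcomplex R) = 0 by rewrite /= expr0n /= addr0 sqrtr0.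
  have [sc|cs] := ltP s c.
    have : s%:E < rearrf mu u 1 by rewrite rc lte_fin.
    rewrite lt_rearrf// => ->; apply: le_measure; rewrite ?inE.
    - exact: measurable_lt_fun (proj1 MfA).
    - exact: measurable_lt_fun.
    by move=> x /=; rewrite /fA; case: ifP => // _; rewrite fA0 lte_fin ltNge s0.
  rewrite (_ : [set x | _] = set0); first by rewrite measure0; case: ifP.
  apply/seteqP; split => // x /=; rewrite /fA; case: ifPn => [_|xH].
    by rewrite fA0 lte_fin ltNge s0.
  move=> sfx; move: xH; rewrite notin_setE; apply; rewrite /H /=.
  by apply: le_lt_trans sfx; rewrite lee_fin.
apply: (@le_trans _ _ (A fA + B fB)); last by rewrite addeC leeD.
apply: ereal_inf_lbound; exists fA, fB; split => //.
- by split => //; exact: le_lt_trans Ale Afin.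
- by split => //; exact: le_lt_trans Ble Bfin.
- apply: aeW => x; rewrite /fA /fB; case: ifPn => [/set_mem|_].
    by case: (f x) => //= z _; rewrite add0r.
  by case: (f x) (f0 x) => //= z _; rewrite addr0.
Qed.

(** * Lower bound for the sum functional *)

Context (CB : R) (CB0 : (0 < CB)%R)
  (CBP : forall u, local_profile mu u -> pnorm B u <= CB%:E * pnorm A u).
Context (CA : R) (CA0 : (0 < CA)%R)
  (CAP : forall u, global_profile mu u -> pnorm A u <= CA%:E * pnorm B u).

Lemma amalgam_le_sum_norm : exists M : R, (1 <= M)%R /\
  forall f : T -> xcomplex R, xmeasurable f ->
    amalgam_norm f <= M%:E * sum_norm mu A B f.
Proof.
have [K [K1 KP]] := amalgam_triangle.
have K0 := le_trans ler01 K1.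
have M1 : (1 <= K * (1 + CA + CB))%R.
  by apply: mulr_ege1 => //; have := ltW CA0; have := ltW CB0; lra.
(* [K] comes from splitting [f] into [fA] and [fB]. The amalgam of [fA] costs [1 + CB], its local
   part passing from [B] to [A]; that of [fB] costs [1 + CA], its global part passing from [A] to
   [B]. The factor [1 + CA + CB] covers both. *)
exists (K * (1 + CA + CB))%R; split => // f mf.
have M0 : (0 < K * (1 + CA + CB))%R by exact: lt_le_trans ltr01 M1.
rewrite -lee_pdivrMl//; apply: le_ereal_inf_tmp => _ [fA [fB [[mfA _] [mfB _] ffAB ->]]].
rewrite lee_pdivrMl//.
have MA := Mplus_xmod mfA; have MB := Mplus_xmod mfB.
have A0 : 0 <= A fA by exact: (qbfn_ge0 HA).
have B0 : 0 <= B fB by exact: (qbfn_ge0 HB).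
have boundA : amalgam (fun x => xmod (fA x)) <= (1 + CA + CB)%:E * A fA.
  rewrite -(pnorm_xmod HA mfA) in A0 *.
  apply: (@le_trans _ _ ((CB + 1)%:E * pnorm A (fun x => xmod (fA x)))).
    rewrite EFinD ge0_muleDl ?lee_fin ?(ltW CB0)// mul1e leeD ?pnorm_global_part_le//.
    apply: le_trans (CBP (local_profile_part MA)) _.
    by rewrite lee_wpmul2l ?lee_fin ?(ltW CB0)// pnorm_local_part_le.
  by rewrite lee_wpmul2r// lee_fin; have := ltW CA0; lra.
have boundB : amalgam (fun x => xmod (fB x)) <= (1 + CA + CB)%:E * B fB.
  rewrite -(pnorm_xmod HB mfB) in B0 *.
  apply: (@le_trans _ _ ((1 + CA)%:E * pnorm B (fun x => xmod (fB x)))).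
    rewrite EFinD ge0_muleDl ?lee_fin ?(ltW CA0)// mul1e leeD ?pnorm_local_part_le//.
    apply: le_trans (CAP (global_profile_part MB)) _.
    by rewrite lee_wpmul2l ?lee_fin ?(ltW CA0)// pnorm_global_part_le.
  by rewrite lee_wpmul2r// lee_fin; have := ltW CB0; lra.
apply: (@le_trans _ _ (amalgam (fun x => xmod (fA x) + xmod (fB x)))).
  apply: amalgam_le; [exact: Mplus_xmod|exact: Mplus_add|].
  by apply: filterS ffAB => x ->; exact: xmodD.
apply: le_trans (KP _ _ MA MB) _.
rewrite EFinM -muleA lee_wpmul2l ?lee_fin// ge0_muleDr//.
exact: leeD.
Qed.

End Amalgam.

Theorem corollary3p5 (d : measure_display) (T : measurableType d)
    (R : realType) (mu : {sigma_finite_measure set T -> \bar R})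
    (A B : (T -> xcomplex R) -> \bar R) :
  nonatomic mu ->
  mu setT = +oo ->
  ri_qbf_norm mu A ->
  ri_qbf_norm mu B ->
  local_component_stronger mu A B ->
  global_component_stronger mu B A ->
  exists (N : (T -> xcomplex R) -> \bar R) (c C : R),
    [/\ ri_qbf_norm mu N,
        (0 < c)%R /\ (c <= C)%R &
        forall f : T -> xcomplex R, xmeasurable f ->
          c%:E * N f <= sum_norm mu A B f /\
          sum_norm mu A B f <= C%:E * N f].
Proof.
move=> na muT HA HB lAB gBA.
have sf : sigma_finite setT mu := sigma_finiteT mu.
have [CB [CB0 CBP]] := local_bound na sf muT HA HB lAB.
have [CA [CA0 CAP]] := global_bound na sf muT HB HA gBA.
have [M [M1 MP]] := amalgam_le_sum_norm na sf muT HA HB CB0 CBP CA0 CAP.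
have M0 : (0 < M)%R by exact: lt_le_trans ltr01 M1.
(* The explicit cut of [f] gives the upper constant [1], and [1 <= M] puts [M^-1] below it. *)
exists (amalgam_norm mu A B), M^-1%R, 1%R; split.
- exact: ri_amalgam_norm.
- by rewrite invr_gt0 invf_le1.
- move=> f mf; split; first by rewrite lee_pdivrMl// MP.
  by rewrite mul1e; exact: sum_norm_le_amalgam.
Qed.
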